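(* Let $\Lambda$ be an admissible mean such that $\Lambda(s,t)\to\infty$ as $t\to\infty$ for every $s>0$, and such that, if $\Lambda(0,t)>0$ for $t>0$, then also $\Lambda(0,t)\to\infty$ as $t\to\infty$. Let $(\mathcal{X},Q,\pi)$ be a Markov triple with $\mathcal{X}=\{1,2,3\}$ and such that $Q(x,y)>0$ for all $x\neq y$, and let $\mathcal{W}$ be the associated discrete transport distance on $\mathcal{P}(\mathcal{X})$. Let $(\mu_t)_{t\in[0,1]}$ be a $\mathcal{W}$-geodesic connecting $\mu_0=\delta_1$ to $\mu_1=\delta_2$. Then $\mu_t(3)>0$ for some $0<t<1$.
   Context: Markov triple: $\mathcal{X}$ is a finite set; $Q:\mathcal{X}\times\mathcal{X}\to\mathbb{R}_+=[0,\infty)$ are transition rates with $Q(x,x)=0$; $Q$ is irreducible (any $x,y\in\mathcal{X}$ are connected by a path $x=x_0,\dots,x_n=y$ with $Q(x_{i-1},x_i)>0$); $\pi$ is the unique (strictly positive) stationary probability measure; and $Q$ is reversible: $\pi(x)Q(x,y)=\pi(y)Q(y,x)$ for all $x,y$. $\mathcal{P}(\mathcal{X})$ is the set of probability measures on $\mathcal{X}$; $\delta_x$ is the Dirac measure at $x$. Admissible mean: a continuous function $\Lambda:\mathbb{R}_+\times\mathbb{R}_+\to\mathbb{R}_+$ that is $C^\infty$ on $(0,\infty)^2$, symmetric, positively $1$-homogeneous, non-decreasing in each variable, jointly concave, with $\Lambda(1,1)=1$. Action: let $A:\mathbb{R}^3\to[0,\infty]$, $A(s,t,w)=w^2/\Lambda(s,t)$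 if $w\in\mathbb{R}$ and $s,t>0$; $A(s,t,w)=0$ if $w=0$ and $s,t\ge0$; $A(s,t,w)=+\infty$ otherwise. For $\mu\in\mathcal{P}(\mathcal{X})$, $V:\mathcal{X}\times\mathcal{X}\to\mathbb{R}$ put $\mathcal{A}(\mu,V)=\frac12\sum_{x,y\in\mathcal{X}}A(\mu(x)Q(x,y),\mu(y)Q(y,x),V(x,y))$. Continuity equation: $\mathsf{CE}_1(\mu_0,\mu_1)$ is the set of pairs $(\mu,V)$ with $\mu:[0,1]\to\mathcal{P}(\mathcal{X})$ continuous, $V:[0,1]\to\mathbb{R}^{\mathcal{X}\times\mathcal{X}}$ locally integrable, $\mu|_{t=0}=\mu_0$, $\mu|_{t=1}=\mu_1$, and, in the sense of distributions, $\frac{d}{dt}\mu_t(x)+\frac12\sum_{y\in\mathcal{X}}(V_t(x,y)-V_t(y,x))=0$ for all $x\in\mathcal{X}$. Discrete transport distance: $\mathcal{W}(\mu_0,\mu_1)=\inf\big\{\sqrt{\int_0^1\mathcal{A}(\mu_t,V_t)\,dt}:(\mu,V)\in\mathsf{CE}_1(\mu_0,\mu_1)\big\}$. A $\mathcal{W}$-geodesic is a constant speed geodesic in $(\mathcal{P}(\mathcal{X}),\mathcal{W})$: a curve $(\mu_t)_{t\in[0,1]}$ in $\mathcal{P}(\mathcal{X})$ with $\mathcal{W}(\mu_s,\mu_t)=|t-s|\,\mathcal{W}(\mu_0,\mu_1)$ for all $s,t\in[0,1]$. *)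

(* Defs.v *)
From mathcomp Require Import all_boot all_order all_algebra.
From mathcomp Require Import all_classical all_reals all_analysis.
Set Implicit Arguments.
Unset Strict Implicit.
Unset Printing Implicit Defensive.
Import Order.TTheory GRing.Theory Num.Theory.
Import numFieldNormedType.Exports.

Local Open Scope classical_set_scope.
Local Open Scope ring_scope.

(* Measures on a finite set are given by their weights. *)
Definition is_prob (R : realType) (X : finType) (m : X -> R) : Prop :=
  (forall x, 0 <= m x) /\ \sum_(x : X) m x = 1.

Definition dirac_prob (R : realType) (X : finType) (x : X) : X -> R :=
  fun y => (y == x)%:R.

Definition stationary (R : realType) (X : finType) (Q : X -> X -> R)
    (m : X -> R) : Prop :=
  forall y, \sum_(x : X) m x * Q x y = m y * \sum_(z : X) Q y z.

Record markov_triple (R : realType) (X : finType) (Q : X -> X -> R)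
    (ppi : X -> R) : Prop := MarkovTriple {
  mt_rate_ge0 : forall x y, 0 <= Q x y;
  mt_rate_diag : forall x, Q x x = 0;
  mt_irreducible : forall x y, connect [rel a b | 0 < Q a b] x y;
  mt_prob : is_prob ppi;
  mt_gt0 : forall x, 0 < ppi x;
  mt_stationary : stationary Q ppi;
  mt_unique : forall m, is_prob m -> stationary Q m -> m = ppi;
  mt_reversible : forall x y, ppi x * Q x y = ppi y * Q y x
}.

(* A mean is a total function [R -> R -> R] of which only
   the values on the closed quadrant are ever constrained or used. *)

(* All iterated partial derivatives of order at most n exist and are continuous
   on the open quadrant. *)
Fixpoint Cn_quadrant (R : realType) (n : nat) (f : R -> R -> R) : Prop :=
  (forall s t, 0 < s -> 0 < t ->
     {for (s, t), continuous (fun p : R * R => f p.1 p.2)}) /\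
  (if n is k.+1 then
     [/\ forall s t, 0 < s -> 0 < t ->
           derivable (fun u : R => f u t) s 1 /\
           derivable (fun u : R => f s u) t 1,
         Cn_quadrant k (fun s t => derive1 (fun u : R => f u t) s) &
         Cn_quadrant k (fun s t => derive1 (fun u : R => f s u) t)]
   else True).

Record admissible_mean (R : realType) (L : R -> R -> R) : Prop := AdmissibleMean {
  am_ge0 : forall s t, 0 <= s -> 0 <= t -> 0 <= L s t;
  am_continuous : {within [set p : R * R | 0 <= p.1 /\ 0 <= p.2],
    continuous (fun p : R * R => L p.1 p.2)};
  am_smooth : forall n, Cn_quadrant n L;
  am_sym : forall s t, 0 <= s -> 0 <= t -> L s t = L t s;
  am_homogeneous : forall c s t, 0 < c -> 0 <= s -> 0 <= t ->
    L (c * s) (c * t) = c * L s t;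
  am_nondecreasing_l : forall s s' t, 0 <= s -> s <= s' -> 0 <= t ->
    L s t <= L s' t;
  am_nondecreasing_r : forall s t t', 0 <= s -> 0 <= t -> t <= t' ->
    L s t <= L s t';
  am_concave : forall a s t s' t', 0 <= a -> a <= 1 ->
    0 <= s -> 0 <= t -> 0 <= s' -> 0 <= t' ->
    a * L s t + (1 - a) * L s' t' <=
    L (a * s + (1 - a) * s') (a * t + (1 - a) * t');
  am_normalized : L 1 1 = 1
}.

Definition action_density (R : realType) (L : R -> R -> R) (s t w : R) : \bar R :=
  if (0 < s) && (0 < t) then (w ^+ 2 / L s t)%:E
  else if [&& w == 0, 0 <= s & 0 <= t] then 0%E
  else +oo%E.

Definition action (R : realType) (X : finType) (L : R -> R -> R)
    (Q : X -> X -> R) (m : X -> R) (V : X -> X -> R) : \bar R :=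
  ((2^-1)%:E * \sum_(x : X) \sum_(y : X)
     action_density L (m x * Q x y)%R (m y * Q y x)%R (V x y))%E.

(* Curves are functions of a real time of which only the restriction to [0, 1]
   matters; test functions have compact support in the open unit interval. *)
Definition test_function (R : realType) (phi : R -> R) : Prop :=
  (forall (n : nat) (t : R), derivable (derive1n n phi) t 1) /\
  (exists a b : R, [/\ 0 < a, b < 1 & forall t, t < a \/ b < t -> phi t = 0]).

(* The library's [locally_integrable] demands an open domain. *)
Definition locally_integrable01 (R : realType) (f : R -> R) : Prop :=
  forall K : set R, K `<=` `[0, 1] -> compact K ->
    (@lebesgue_measure R).-integrable K (EFin \o f).

Record CE1 (R : realType) (X : finType) (m0 m1 : X -> R)
    (mu : R -> X -> R) (V : R -> X -> X -> R) : Prop := InCE1 {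
  ce_prob : forall t, 0 <= t <= 1 -> is_prob (mu t);
  ce_continuous : forall x, {within `[0, 1], continuous (fun t => mu t x)};
  ce_integrable : forall x y, locally_integrable01 (fun t => V t x y);
  ce_start : mu 0 = m0;
  ce_end : mu 1 = m1;
  ce_equation : forall x (phi : R -> R), test_function phi ->
    - (\int[@lebesgue_measure R]_(t in `]0, 1[) (derive1 phi t * mu t x)) +
    \int[@lebesgue_measure R]_(t in `]0, 1[)
      (phi t * (2^-1 * \sum_(y : X) (V t x y - V t y x))) = 0
}.

Definition transport_dist (R : realType) (X : finType) (L : R -> R -> R)
    (Q : X -> X -> R) (m0 m1 : X -> R) : \bar R :=
  ereal_inf [set d : \bar R | exists mu V, CE1 m0 m1 mu V /\
    d = sqrte (\int[@lebesgue_measure R]_(t in `[0%R, 1%R])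
                 action L Q (mu t) (V t))%E].

Definition transport_geodesic (R : realType) (X : finType) (L : R -> R -> R)
    (Q : X -> X -> R) (mu : R -> X -> R) : Prop :=
  (forall t, 0 <= t <= 1 -> is_prob (mu t)) /\
  (forall s t, 0 <= s <= 1 -> 0 <= t <= 1 ->
    transport_dist L Q (mu s) (mu t) =
    (`|t - s|%:E * transport_dist L Q (mu 0%R) (mu 1%R))%E).

(* The three-point space {1, 2, 3} is ['I_3], whose elements are 0, 1, 2. *)
Definition pt1 : 'I_3 := @Ordinal 3 0 isT.
Definition pt2 : 'I_3 := @Ordinal 3 1 isT.
Definition pt3 : 'I_3 := @Ordinal 3 2 isT.

(* Main.v *)
Require Import Defs.
From mathcomp Require Import all_boot all_order all_algebra.
From mathcomp Require Import all_classical all_reals all_analysis.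
From mathcomp Require Import measurable_realfun ring lra.
Import Order.TTheory GRing.Theory Num.Theory.
Import numFieldNormedType.Exports HBNNSimple.
Local Open Scope classical_set_scope.
Local Open Scope ring_scope.

Set Implicit Arguments.
Unset Strict Implicit.
Unset Printing Implicit Defensive.

(** Suppose that the geodesic never charges the third vertex. It then runs along
    the edge of measures [edge x = (1 - x, x, 0)], and the contradiction comes
    from computing the length of that edge in two ways.

    Lower bound. Write [C x] for the effective conductance between the first two
    vertices at [edge x] ([conductance]): the direct edge in parallel with the
    series connection through the third vertex, which conducts at an empty
    vertex exactly when [L 0 1 > 0]. The action density is a Legendre transform,
    so increments of a linear observable along a curve are bounded by its
    mobility times the action ([pairing_increment_sqr]); this uses the weak
    continuity equation through smooth cutoffs. The observable that is harmonic
    at the third vertex has mobility [C x] at [edge x], hence nearly [C x] along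
    short curves, and the distance from [edge x] to [edge y] is at least about
    [|x - y| / sqrt (C x)] ([edge_dist_lower]). The distance is additive along a
    geodesic, so these local bounds integrate: between [edge a] and
    [edge (1 - a)] the distance is at least [l], the integral of
    [1 / sqrt C] from [a] to [1 - a].

    Upper bound. Run along the edge with the harmonic flow at constant speed, and
    at time [t] move a small fraction [w = eps * sigma t] of the mass to the third
    vertex, taken from the other two in proportion to their masses. By
    homogeneity of [L] the flow scaled by [1 - w] on masses scaled by [1 - w] has
    action [(1 - w) * l ^ 2]: a gain of first order in [eps] ([action_lift]). The
    price has two parts. The exchange itself costs about
    [w' ^ 2 / L (1, w) <= const * eps * w / L (1, w)] if [sigma] is a square, and
    [w / L (1, w) = 1 / L (1 / w, 1)] tends to zero because [L] is unbounded in
    each variable. When [L 0 1 > 0] the exchange also interacts at first order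
    with the flow already passing through the third vertex; that term carries a
    factor [x * (1 - x)] ([cross_uniform]), so it becomes negligible when
    [sigma] rises and falls only near the two ends of the edge, with [a] small.
    Hence the distance between [edge a] and [edge (1 - a)] is smaller than [l]
    ([edge_shortcut]). *)

(** * Smooth functions and cutoffs *)

(** Recursion on the derivative makes the closure properties below plain
    inductions. *)
Fixpoint cdiff (R : realType) (n : nat) (f : R -> R) : Prop :=
  if n is k.+1 then (forall t, derivable f t 1) /\ cdiff k (derive1 f)
  else True.

Lemma cdiff_derivable1n (R : realType) (f : R -> R) :
  (forall n, cdiff n f) -> forall n t, derivable (derive1n n f) t 1.
Proof.
move=> sf n; elim: n f sf => [|n IH] f sf t; first by have [+ _] := sf 1%N; exact.
by rewrite derive1Sn; apply: IH => k; have [] := sf k.+1.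
Qed.

Lemma derive1_is_derive (R : realType) (f g : R -> R) :
  (forall x : R, is_derive x 1 f (g x)) -> derive1 f = g.
Proof. by move=> fg; apply/funext => x; rewrite derive1E; have [_ ->] := fg x. Qed.

Lemma cdiffS (R : realType) n (f g : R -> R) :
  (forall x : R, is_derive x 1 f (g x)) -> cdiff n g -> cdiff n.+1 f.
Proof.
move=> fg ng; split=> [t|]; last by rewrite (derive1_is_derive fg).
by have [] := fg t.
Qed.

Lemma cdiff_is_derive (R : realType) n (f : R -> R) :
  cdiff n.+1 f -> forall x : R, is_derive x 1 f (derive1 f x).
Proof. by case=> df _ x; rewrite derive1E; exact: derivableP. Qed.

Lemma cdiffD (R : realType) n (f g : R -> R) :
  cdiff n f -> cdiff n g -> cdiff n (fun x => f x + g x).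
Proof.
elim: n f g => [//|n IH] f g cf cg.
have df := cdiff_is_derive cf; have dg := cdiff_is_derive cg.
have dfg (x : R) : is_derive x 1 (fun x => f x + g x) (derive1 f x + derive1 g x).
  exact: is_deriveD.
apply: cdiffS dfg _.
by apply: IH; [case: cf|case: cg].
Qed.

Lemma cdiff_pred (R : realType) n (f : R -> R) : cdiff n.+1 f -> cdiff n f.
Proof. by elim: n f => [//|n IH] f [df cf]; split=> //; exact: IH. Qed.

Lemma cdiffM (R : realType) n (f g : R -> R) :
  cdiff n f -> cdiff n g -> cdiff n (fun x => f x * g x).
Proof.
elim: n f g => [//|n IH] f g cf cg.
have df := cdiff_is_derive cf; have dg := cdiff_is_derive cg.
have dfg (x : R) :
    is_derive x 1 (fun x => f x * g x) (f x * derive1 g x + g x * derive1 f x).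
  exact: is_deriveM.
apply: cdiffS dfg _.
apply: cdiffD; apply: IH.
- exact: cdiff_pred.
- by case: cg.
- exact: cdiff_pred.
- by case: cf.
Qed.

Lemma cdiff_cst (R : realType) n (c : R) : cdiff n (fun=> c).
Proof.
elim: n c => [//|n IH] c.
exact: (@cdiffS _ _ _ (fun=> 0) (fun x => is_derive_cst c x 1)).
Qed.

Lemma is_derive_affine (R : realType) (a b x : R) :
  is_derive x 1 (fun y => a * y + b) a.
Proof.
have -> : (fun y => a * y + b) = a \*: id + cst b by apply/funext.
by apply: is_derive_eq; rewrite /GRing.scale /= mulr1 addr0.
Qed.

Lemma cdiff_affine (R : realType) n (a b : R) (f : R -> R) :
  cdiff n f -> cdiff n (fun x => f (a * x + b)).
Proof.
elim: n f => [//|n IH] f cf; have df := cdiff_is_derive cf.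
have dfg (x : R) :
    is_derive x 1 (fun x => f (a * x + b)) (derive1 f (a * x + b) * a).
  apply: (@is_derive1_comp _ f (fun x => a * x + b)).
  exact: is_derive_affine.
apply: cdiffS dfg _.
by apply: cdiffM; [apply: IH; case: cf|exact: cdiff_cst].
Qed.

Lemma is_derive_exprn (R : realType) (f : R -> R) n (x df : R) :
  is_derive x 1 f df ->
  is_derive x 1 (fun y => f y ^+ n) (n%:R * f x ^+ n.-1 * df).
Proof.
move=> fd; have -> : (fun y => f y ^+ n) = f ^+ n by rewrite exprfctE.
exact: is_deriveX.
Qed.

(** The functions [exp (- 1 / x) / x ^ k], extended by zero, span a space stable
    under differentiation; hence the flat exponential, [k = 0], is smooth. *)
Definition flat_exp (R : realType) (k : nat) (x : R) : R :=
  if 0 < x then x ^- k * expR (- x^-1) else 0.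

(** From [y ^ (k + 1) <= (k + 1)! * exp y] at [y = 1 / x]. *)
Lemma flat_exp_le (R : realType) k (x : R) :
  `|flat_exp k x| <= (k.+1)`!%:R * `|x|.
Proof.
rewrite /flat_exp; case: ifPn => [x0|_]; last by rewrite normr0 mulr_ge0.
have xi0 : 0 < x^-1 by rewrite invr_gt0.
rewrite ger0_norm ?mulr_ge0 ?expR_ge0 ?invr_ge0 ?exprn_ge0 ?(ltW x0) //.
rewrite gtr0_norm // expRN ler_pdivrMr ?expR_gt0 // mulrAC -ler_pdivrMr //.
rewrite -exprVn -exprSr.
have := expR_ge1Dxn k (ltW xi0).
have f0 : 0 < (k.+1)`!%:R :> R by rewrite ltr0n fact_gt0.
rewrite -ler_pdivrMl // => /(le_trans _); apply.
by rewrite mulrC lerDr.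
Qed.

Lemma flat_exp_cvg0 (R : realType) k : {for 0, continuous (@flat_exp R k)}.
Proof.
have f00 : flat_exp k (0 : R) = 0 by rewrite /flat_exp ltxx.
rewrite /prop_for /continuous_at. rewrite f00.
apply/cvgr0Pnorm_le => e e0.
have f0 : 0 < (k.+1)`!%:R :> R by rewrite ltr0n fact_gt0.
near=> x; apply: le_trans (flat_exp_le _ _) _.
rewrite -ler_pdivlMl //; near: x.
have : (fun x : R => x) x @[x --> 0] --> (0 : R) by exact: cvg_id.
move/cvgr0Pnorm_le; apply; rewrite mulr_gt0 ?invr_gt0 //.
Unshelve. all: by end_near. Qed.

(** At the origin the difference quotient of [flat_exp k] is [flat_exp k.+1],
    which tends to zero. *)
Lemma is_derive_flat_exp (R : realType) k (x : R) :
  is_derive x 1 (flat_exp k) (- k%:R * flat_exp k.+1 x + flat_exp k.+2 x).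
Proof.
have [x0|x0|->] := ltgtP x 0.
- have -> : - k%:R * flat_exp k.+1 x + flat_exp k.+2 x = 0.
    by rewrite /flat_exp (lt_gtF x0) mulr0 addr0.
  apply: (@near_eq_is_derive _ _ _ (cst 0)).
  near=> y; rewrite /flat_exp lt_gtF //; near: y; exact: lt_nbhsl.
- have -> : - k%:R * flat_exp k.+1 x + flat_exp k.+2 x =
     - k%:R * (x ^- k.+1 * expR (- x^-1)) + x ^- k.+2 * expR (- x^-1).
    by rewrite /flat_exp x0.
  have dV : is_derive x 1 (fun y : R => y^-1) (- x ^- 2).
    have := @is_deriveV R id x 1 1.
    rewrite /GRing.scale /= mulr1; apply; first by rewrite gt_eqF.
  have dE : is_derive x 1 (fun y : R => expR (- y^-1)) (expR (- x^-1) * - - x ^- 2).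
    apply: (@is_derive1_comp _ expR (fun y => - y^-1)).
  have dX := is_derive_exprn k dV.
  apply: (@near_eq_is_derive _ _ _ (fun y : R => (y^-1) ^+ k * expR (- y^-1))).
    near=> y; rewrite /flat_exp exprVn ifT //; near: y; exact: lt_nbhsr.
  have := @is_deriveM _ _ (fun y : R => (y^-1) ^+ k)
     (fun y : R => expR (- y^-1)) x 1 _ _ dX dE.
  move=> H; apply: is_derive_eq.
  rewrite /GRing.scale /= -!exprVn; case: k {dX H} => [|k] /=.
    by rewrite expr0; ring.
  by rewrite !exprS; ring.
- have -> : - k%:R * flat_exp k.+1 0 + flat_exp k.+2 0 = 0 :> R.
    by rewrite /flat_exp ltxx mulr0 addr0.
  apply/is_derive1_caratheodory; exists (flat_exp k.+1); split.
  + move=> z; rewrite /flat_exp ltxx !subr0; case: ifPn => z0; last by rewrite mul0r.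
    by rewrite mulrAC exprSr invfM divfK // gt_eqF.
  + exact: flat_exp_cvg0.
  + by rewrite /flat_exp ltxx.
Unshelve. all: by end_near. Qed.

Lemma cdiff_flat_exp (R : realType) n k : cdiff n (@flat_exp R k).
Proof.
elim: n k => [//|n IH] k; apply: cdiffS (@is_derive_flat_exp R k) _.
by apply: cdiffD => //; apply: cdiffM => //; exact: cdiff_cst.
Qed.

Definition bump (R : realType) (x : R) : R := flat_exp 0 x * flat_exp 0 (1 - x).

Lemma flat_exp_ge0 (R : realType) k (x : R) : 0 <= flat_exp k x.
Proof.
rewrite /flat_exp; case: ifPn => // x0.
by rewrite mulr_ge0 ?expR_ge0 ?invr_ge0 ?exprn_ge0 // ltW.
Qed.

Lemma cdiff_bump (R : realType) n : cdiff n (@bump R).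
Proof.
apply: cdiffM; first exact: cdiff_flat_exp.
have -> : (fun x : R => flat_exp 0 (1 - x)) = (fun x => flat_exp 0 (-1 * x + 1)).
  by apply/funext => x; rewrite mulN1r addrC.
by apply: cdiff_affine; exact: cdiff_flat_exp.
Qed.

Lemma bump_ge0 (R : realType) (x : R) : 0 <= bump x.
Proof. by rewrite mulr_ge0 ?flat_exp_ge0. Qed.

Lemma bump_out (R : realType) (x : R) : x <= 0 \/ 1 <= x -> bump x = 0.
Proof.
rewrite /bump /flat_exp subr_gt0; case=> x01; first by rewrite ltNge x01 mul0r.
by rewrite [X in _ * X]ifF ?mulr0 // ltNge x01.
Qed.

Lemma bump_gt0 (R : realType) (x : R) : 0 < x -> x < 1 -> 0 < bump x.
Proof.
move=> x0 x1; rewrite /bump /flat_exp subr_gt0 x0 x1.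
by rewrite !expr0 invr1 !mul1r mulr_gt0 ?expR_gt0.
Qed.

Lemma cdiff_continuous (R : realType) (f : R -> R) : cdiff 1 f -> continuous f.
Proof.
by move=> [df _] x; apply/differentiable_continuous/derivable1_diffP.
Qed.

Lemma continuous_itv_integrable (R : realType) (f : R -> R) (a b : R) :
  {within `[a, b], continuous f} ->
  (@lebesgue_measure R).-integrable `[a, b] (EFin \o f).
Proof.
move=> cf; apply: continuous_compact_integrable => //.
exact: segment_compact.
Qed.

(** A smooth transition from 0 to 1 on the unit interval, the primitive of a
    normalized bump. *)
Lemma smooth_step (R : realType) : exists G g : R -> R,
  [/\ forall x : R, is_derive x 1 G (g x), forall n, cdiff n g,
      forall x, 0 <= g x, forall x, x <= 0 \/ 1 <= x -> g x = 0 &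
      (forall x, x <= 0 -> G x = 0) /\ (forall x, 1 <= x -> G x = 1)].
Proof.
have cb : continuous (@bump R) by apply: cdiff_continuous; exact: cdiff_bump.
pose F (x : R) := \int[lebesgue_measure]_(t in `[-1, x]) (bump t).
have intb (a b : R) : (@lebesgue_measure R).-integrable `[a, b] (EFin \o @bump R).
  by apply: continuous_itv_integrable; exact: continuous_subspaceT.
have F0 x : x <= 0 -> F x = 0.
  move=> x0; rewrite /F; under eq_Rintegral.
    move=> t; rewrite inE /= in_itv /= => /andP[_ tx].
    rewrite bump_out; last by left; exact: le_trans x0.
    over.
  by rewrite Rintegral_cst // mul0r.
have dF (x : R) : is_derive x 1 F (bump x).
  have [x1|x1] := ltP x 0.
    rewrite bump_out; last by left; exact: ltW.
    apply: (@near_eq_is_derive _ _ _ (cst 0)).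
    by near=> y; rewrite F0 //; apply: ltW; near: y; exact: lt_nbhsl.
  have x2 : (BLeft (-1) < BRight x)%O by rewrite bnd_simp; lra.
  have [] := @continuous_FTC1_closed R (@bump R) (-1) x (x + 1) _ (intb _ _) _ (cb x).
  - by rewrite ltrDl.
  - by lra.
  by move=> dFx <-; rewrite derive1E; exact: derivableP.
have dFw (a b : R) : {within `[a, b], continuous F}.
  apply: derivable_within_continuous => x _; by have [] := dF x.
have F1 x : 1 <= x -> F x = F 1.
  move=> x1; have [c cx] := MVT_segment x1 (fun x _ => dF x) (dFw _ _).
  move: cx; rewrite in_itv /= => /andP[c1 _].
  by rewrite bump_out ?mul0r; [move/eqP; rewrite subr_eq0 => /eqP|right].
have F1_gt0 : 0 < F 1.
  have [c] := @MVT R F (@bump R) 0 1 ltr01 (fun x _ => dF x) (dFw _ _).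
  rewrite in_itv /= => /andP[c0 c1].
  by rewrite (F0 0) // !subr0 mulr1 => ->; exact: bump_gt0.
exists (fun x => (F 1)^-1 * F x), (fun x => (F 1)^-1 * bump x); split.
- by move=> x; have := @is_deriveZ _ _ _ F (F 1)^-1 x 1 _ (dF x).
- by move=> n; apply: cdiffM; [exact: cdiff_cst|exact: cdiff_bump].
- by move=> x; rewrite mulr_ge0 ?bump_ge0 // invr_ge0 ltW.
- by move=> x x01; rewrite bump_out // mulr0.
split=> x hx; first by rewrite (F0 x) // mulr0.
by rewrite (F1 x) // mulVf // gt_eqF.
Unshelve. all: by end_near. Qed.

Lemma is_derive_continuous (R : realType) (f : R -> R) (x df : R) :
  is_derive x 1 f df -> {for x, continuous f}.
Proof. by move=> [d _]; exact/differentiable_continuous/derivable1_diffP. Qed.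

(** * Integration on the unit interval *)

Lemma Rintegral_oo01 (R : realType) (f : R -> R) :
  (@lebesgue_measure R).-integrable `[0, 1] (EFin \o f) ->
  \int[@lebesgue_measure R]_(t in `]0, 1[) f t =
  \int[@lebesgue_measure R]_(t in `[0, 1]) f t.
Proof.
move=> intf.
have intS (i : interval R) : [set` i] `<=` `[0, 1] ->
    (@lebesgue_measure R).-integrable [set` i] (EFin \o f).
  by move=> i01; exact: integrableS intf.
rewrite Rintegral_itv_bndo_bndc ?Rintegral_itv_obnd_cbnd //; apply: intS.
- by apply: subset_itv; rewrite bnd_simp.
- by apply: subset_itv; rewrite bnd_simp.
Qed.

Lemma within_continuousM (R : realType) (A : set R) (f g : R -> R) :
  {within A, continuous f} -> {within A, continuous g} ->
  {within A, continuous (fun x => f x * g x)}.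
Proof. by move=> cf cg x; apply: continuousM; [exact: cf|exact: cg]. Qed.

(** Monotonicity straight from the definition of the integral as a supremum over
    simple functions, in a form that applies to the action along an arbitrary
    curve. *)
Lemma ge0_le_integral_sub d (T : measurableType d) (R : realType)
    (m : {measure set T -> \bar R}) (D E : set T) (f g : T -> \bar R) :
  D `<=` E -> (forall x, D x -> 0 <= f x)%E -> (forall x, E x -> 0 <= g x)%E ->
  (forall x, D x -> f x <= g x)%E ->
  (\int[m]_(x in D) f x <= \int[m]_(x in E) g x)%E.
Proof.
move=> DE f0 g0 fg; rewrite !ge0_integralE //.
apply: ereal_sup_le => _ [h /= hf <-].
exists h => //= x; apply: le_trans (hf x) _.
rewrite /patch; case: ifPn => [|_].
  by rewrite inE => Dx; rewrite ifT ?fg // inE; exact: DE.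
by case: ifPn => // /[!inE]; exact: g0.
Qed.

(** Signed integrable minorants bound the action from below in this way. *)
Lemma Rintegral_le_integral d (T : measurableType d) (R : realType)
    (m : {measure set T -> \bar R}) (D E : set T) (f : T -> R) (g : T -> \bar R) :
  measurable D -> D `<=` E -> m.-integrable D (EFin \o f) ->
  (forall x, E x -> 0 <= g x)%E -> (forall x, D x -> (f x)%:E <= g x)%E ->
  ((\int[m]_(x in D) f x)%:E <= \int[m]_(x in E) g x)%E.
Proof.
move=> mD DE intf g0 fg.
have -> : (\int[m]_(x in D) f x)%:E = (\int[m]_(x in D) (f x)%:E)%E.
  by rewrite /Rintegral fineK // integrable_fin_num.
apply: (@le_trans _ _ (\int[m]_(x in D) (EFin \o f)^\+ x)%E).
  apply: le_integral => //; first exact: integrable_funepos.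
  by move=> x _; rewrite funeposE le_max lexx.
apply: ge0_le_integral_sub => // x Dx; rewrite funeposE /=.
by rewrite ge_max fg // g0 //; exact: DE.
Qed.

(** Rescaled steps, with their densities. Later steps are smaller, so that the
    difference of two steps is a cutoff with values between 0 and 1. *)
Lemma smooth_kernel (R : realType) : exists G g : R -> R -> R -> R,
  (forall s t d x : R, 0 < d -> s <= t -> G t d x <= G s d x) /\
  forall s d : R, 0 < d ->
  [/\ forall x : R, is_derive x 1 (G s d) (g s d x), forall n, cdiff n (g s d),
      forall x, 0 <= g s d x,
      forall x, x <= s \/ s + d <= x -> g s d x = 0 &
      [/\ forall x, x <= s -> G s d x = 0, forall x, s + d <= x -> G s d x = 1 &
          forall x, 0 <= G s d x <= 1]].
Proof.
have [G [g [dG sg g0 gout [G0 G1]]]] := smooth_step R.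
have Gnd x y : x <= y -> G x <= G y.
  move=> xy; have [|c _ /eqP] := MVT_segment xy (fun x _ => dG x).
    by apply: derivable_within_continuous => z _; have [] := dG z.
  by rewrite subr_eq => /eqP ->; rewrite lerDr mulr_ge0 // subr_ge0.
exists (fun s d x => G (d^-1 * x - d^-1 * s)).
exists (fun s d x => g (d^-1 * x - d^-1 * s) * d^-1).
split=> [s t d x d0 st|s d d0].
  by apply: Gnd; rewrite lerD2l lerN2 ler_wpM2l // invr_ge0 ltW.
have le0 x : x <= s -> d^-1 * x - d^-1 * s <= 0.
  by move=> xs; rewrite -mulrBr mulr_ge0_le0 ?invr_ge0 ?subr_le0 // ltW.
have le1 x : s + d <= x -> 1 <= d^-1 * x - d^-1 * s.
  by move=> xs; rewrite -mulrBr mulrC ler_pdivlMr // mul1r lerBrDl.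
split.
- move=> x; apply: (@is_derive1_comp _ G (fun x => d^-1 * x - d^-1 * s)).
  exact: is_derive_affine.
- move=> n; apply: cdiffM; last exact: cdiff_cst.
  exact: cdiff_affine.
- by move=> x; rewrite mulr_ge0 // invr_ge0 ltW.
- by move=> x [/le0|/le1] ?; rewrite gout ?mul0r //; [left|right].
split=> x.
- by move=> /le0 /G0.
- by move=> /le1 /G1.
set y := _ - _; apply/andP; split.
  have [y0|y0] := leP 0 y; last by rewrite G0 // ltW.
  by rewrite -(G0 0) // Gnd.
have [y0|y0] := leP y 1; last by rewrite G1 // ltW.
by rewrite -(G1 1) // Gnd.
Qed.

(** The derivative of a cutoff is the difference of two kernels of unit mass,
    concentrated near [s] and near [t]; so it detects the increment of a merely
    continuous function between these times. *)
Lemma cutoff (R : realType) (s t d : R) : 0 < s -> s <= t -> 0 < d -> t + d < 1 ->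
  exists phi : R -> R, [/\ test_function phi, forall x, 0 <= phi x <= 1 &
    forall (M : R -> R) (m1 m2 : R), {within `[0, 1], continuous M} ->
      (forall x, s <= x <= s + d -> M x <= m1) ->
      (forall x, t <= x <= t + d -> m2 <= M x) ->
      m2 - m1 <= - \int[@lebesgue_measure R]_(x in `]0, 1[) (derive1 phi x * M x)].
Proof.
move=> s0 st d0 td1; have [G [g [Gnd Gg]]] := smooth_kernel R.
have [dGs sgs gs0 gsout [Gs0 Gs1 Gs01]] := Gg s d d0.
have [dGt sgt gt0 gtout [Gt0 Gt1 Gt01]] := Gg t d d0.
pose phi x := G s d x - G t d x.
have dphi (x : R) : is_derive x 1 phi (g s d x - g t d x) by exact: is_deriveB.
exists phi; split.
- split.
    apply: cdiff_derivable1n => -[//|n]; apply: cdiffS dphi _.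
    apply: cdiffD => //.
    have -> : (fun x => - g t d x) = (fun x => -1 * g t d x).
      by apply/funext => x; rewrite mulN1r.
    by apply: cdiffM => //; exact: cdiff_cst.
  exists s, (t + d); split=> // x [xs|xt]; rewrite /phi.
    by rewrite Gs0 ?Gt0 ?subrr //; lra.
  by rewrite Gs1 ?Gt1 ?subrr //; lra.
- move=> x; rewrite /phi; have /andP[a1 a2] := Gs01 x; have /andP[b1 b2] := Gt01 x.
  by have := Gnd s t d x d0 st; lra.
move=> M m1 m2 cM M1 M2.
have cg u : {within `[0, 1], continuous (g u d)}.
  have [_ sg _ _ _] := Gg u d d0.
  by apply: continuous_subspaceT; apply: cdiff_continuous; exact: sg.
have int (f : R -> R) : {within `[0, 1], continuous f} ->
    (@lebesgue_measure R).-integrable `[0, 1] (EFin \o f).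
  exact: continuous_itv_integrable.
have mass u : 0 < u -> u + d < 1 ->
    \int[@lebesgue_measure R]_(x in `[0, 1]) g u d x = 1.
  move=> u0 u1; have [dGu _ _ _ [Gu0 Gu1 _]] := Gg u d d0.
  rewrite /Rintegral (@continuous_FTC2 _ _ (G u d)) //.
  - by rewrite (Gu0 0 (ltW u0)) (Gu1 1 (ltW u1)) sube0.
  - split => [x _|  |]; first by have [] := dGu x.
      apply: cvg_at_right_filter.
      by apply/differentiable_continuous/derivable1_diffP; have [] := dGu 0.
    apply: cvg_at_left_filter.
    by apply/differentiable_continuous/derivable1_diffP; have [] := dGu 1.
  - by move=> x _; rewrite (derive1_is_derive dGu).
rewrite (derive1_is_derive dphi).
have cgM u : {within `[0, 1], continuous (fun x => g u d x * M x)}.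
  exact: within_continuousM.
rewrite (_ : (fun _ => _) = fun x => g s d x * M x - g t d x * M x); last first.
  by apply/funext => x; rewrite mulrBl.
rewrite Rintegral_oo01; last first.
  by apply: int; exact: (within_continuousB (cgM s) (cgM t)).
rewrite RintegralB //; [|exact: int|exact: int].
rewrite opprB; apply: lerB.
  have -> : m2 = \int[@lebesgue_measure R]_(x in `[0, 1]) (m2 * g t d x).
    rewrite RintegralZl ?mass ?mulr1 //; last exact: int.
    exact: lt_le_trans st.
  apply: le_Rintegral => //.
  - by apply: int; apply: within_continuousM => //; exact: cst_continuous.
  - exact: int.
  move=> x _; have [xt|xt] := boolP (t <= x <= t + d).
    by rewrite mulrC ler_wpM2l // M2.
  by rewrite (gtout x) ?mulr0 ?mul0r //; lra.
have -> : m1 = \int[@lebesgue_measure R]_(x in `[0, 1]) (m1 * g s d x).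
  rewrite RintegralZl ?mass ?mulr1 //; last exact: int.
  by rewrite (le_lt_trans _ td1) // lerD2r.
apply: le_Rintegral => //.
- exact: int.
- by apply: int; apply: within_continuousM => //; exact: cst_continuous.
move=> x _; have [xt|xt] := boolP (s <= x <= s + d).
  by rewrite mulrC ler_wpM2r // M1.
by rewrite (gsout x) ?mulr0 ?mul0r //; lra.
Qed.

Lemma integrable_Rsum d (T : measurableType d) (R : realType)
    (m : {measure set T -> \bar R}) (D : set T) (I : finType) (F : I -> T -> R) :
  measurable D -> (forall i, m.-integrable D (EFin \o F i)) ->
  m.-integrable D (EFin \o (fun x => \sum_i F i x)).
Proof.
move=> mD intF.
have -> : EFin \o (fun x => \sum_i F i x) = (fun x => (\sum_i (EFin \o F i) x)%E).
  by apply/funext => x /=; rewrite sumEFin.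
exact: integrable_sum.
Qed.

Lemma Rintegral_sum d (T : measurableType d) (R : realType)
    (m : {measure set T -> \bar R}) (D : set T) (I : finType) (F : I -> T -> R) :
  measurable D -> (forall i, m.-integrable D (EFin \o F i)) ->
  \int[m]_(x in D) (\sum_i F i x) = \sum_i \int[m]_(x in D) F i x.
Proof.
move=> mD intF; rewrite /Rintegral.
under eq_integral do rewrite -sumEFin.
by rewrite integral_sum // -sum_fine // => i _; exact: integrable_fin_num (intF i).
Qed.

Lemma integrable_Zl d (T : measurableType d) (R : realType)
    (m : {measure set T -> \bar R}) (D : set T) (k : R) (f : T -> R) :
  measurable D -> m.-integrable D (EFin \o f) ->
  m.-integrable D (EFin \o (fun x => k * f x)).
Proof. by move=> mD intf; exact: (integrableZl mD k intf). Qed.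

(** The bound is asked on the open interval: the action of the competitors below
    may be infinite at the two endpoints. *)
Lemma integral_le_interior (R : realType) (f : R -> \bar R) (E : R -> R) :
  {within `[0, 1], continuous E} ->
  (forall t, 0 <= f t)%E ->
  (forall t, 0 < t < 1 -> (f t <= (E t)%:E)%E) ->
  (\int[@lebesgue_measure R]_(t in `[0%R, 1%R]) f t <=
   (\int[@lebesgue_measure R]_(t in `[0, 1]) E t)%R%:E)%E.
Proof.
move=> cE f0 fE; have intE := continuous_itv_integrable cE.
have intEo : (@lebesgue_measure R).-integrable `]0, 1[ (EFin \o E).
  by apply: integrableS intE => //; apply: subset_itv; rewrite bnd_simp.
rewrite -Rintegral_oo01 //.
have -> : (\int[@lebesgue_measure R]_(t in `]0, 1[) E t)%:E =
    (\int[@lebesgue_measure R]_(t in `]0%R, 1%R[) (E t)%:E)%E.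
  by rewrite /Rintegral fineK // integrable_fin_num.
rewrite ge0_integralE //; apply: ge_ereal_sup => _ [h /= hf <-].
have h01 (x : R) : ~~ (0 <= x <= 1) -> h x = 0.
  move=> x01; apply/eqP; rewrite eq_le fun_ge0 andbT -lee_fin.
  apply: le_trans (hf x) _; rewrite patchE ifF //.
  by apply/negP; rewrite inE /= in_itv /=; exact/negP.
have -> : sintegral (@lebesgue_measure R) h =
    (\int[@lebesgue_measure R]_(t in `[0%R, 1%R]) (h t)%:E)%E.
  rewrite integral_nnsfun //; congr sintegral; apply/funext => x /=.
  rewrite patchE; case: ifPn => // x01; apply: h01; apply: contra x01 => x01.
  by rewrite inE /= in_itv.
have mh D : measurable D -> measurable_fun D (EFin \o h).
  by move=> mD; apply/measurable_EFinP; apply: measurable_funTS.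
rewrite -integral_itv_bndo_bndc; last by apply: mh.
rewrite -integral_itv_obnd_cbnd; last by apply: mh.
apply: ge0_le_integral => //.
- by move=> x _; rewrite lee_fin.
- exact: mh.
- by have /integrableP[] := intEo.
- move=> x; rewrite /= in_itv /= => x01; apply: le_trans (fE x x01).
  by apply: le_trans (hf x) _; rewrite patchE; case: ifP.
Qed.

(** Here [M] is the mobility of an edge at the third vertex, [n * lam] the part of
    it that remains when that vertex is empty, [h * lam] the flow already present
    and [z] the perturbation. For [lam = 0] there is no flow to interact with, and
    the cross term disappears altogether. *)
Lemma sqr_sum_div_le (R : realType) (h lam y z n M : R) :
  0 < n -> 0 < M -> 0 <= lam -> n * lam <= M -> 0 <= h -> 0 <= y <= 1 ->
  (h * lam + y * z) ^+ 2 / M <=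
  h ^+ 2 * lam / n + (if lam == 0 then 0 else 2 * h * y * `|z| / n) + z ^+ 2 / M.
Proof.
move=> n0 M0 lam0 nM h0 /andP[y0 y1].
have lM : lam / M <= n^-1.
  by rewrite ler_pdivrMr // mulrC ler_pdivlMr // mulrC.
have lM0 : 0 <= lam / M by rewrite divr_ge0 // ltW.
have -> : (h * lam + y * z) ^+ 2 / M =
    h ^+ 2 * lam * (lam / M) + 2 * h * y * z * (lam / M) + y ^+ 2 * (z ^+ 2 / M).
  by ring.
apply: lerD; last first.
  by rewrite ler_piMl ?divr_ge0 ?sqr_ge0 ?(ltW M0) // expr_le1.
apply: lerD; first by rewrite ler_wpM2l // mulr_ge0 ?sqr_ge0.
case: ifP => [/eqP ->|_]; first by rewrite mul0r mulr0.
have hy : 0 <= 2 * h * y by rewrite !mulr_ge0.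
apply: (@le_trans _ _ (2 * h * y * `|z| * (lam / M))).
  by rewrite ler_wpM2r // ler_wpM2l // ler_norm.
by rewrite ler_wpM2l // mulr_ge0.
Qed.

Lemma Rintegral_pow01 (R : realType) k :
  \int[@lebesgue_measure R]_(t in `[0, 1]) ((2 * t - 1) ^+ 2) ^+ k =
  (k.*2.+1)%:R^-1.
Proof.
pose F (t : R) := (k.*2.+1)%:R^-1 * (2^-1 * (2 * t - 1) ^+ k.*2.+1).
have dA (t : R) : is_derive t 1 (fun t : R => 2 * t - 1) 2 by exact: is_derive_affine.
have k0 : (k.*2.+1)%:R != 0 :> R by rewrite pnatr_eq0.
have dF (t : R) : is_derive t 1 F (((2 * t - 1) ^+ 2) ^+ k).
  have H := is_derive_exprn k.*2.+1 (dA t).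
  have := is_deriveZ (k.*2.+1)%:R^-1 (is_deriveZ 2^-1 H).
  move=> H2; apply: (@is_derive_eq _ _ _ F _ _ _ _ H2).
  rewrite /GRing.scale /= -exprM mul2n; set z := _ ^+ _.
  by move: k0; move: (k.*2.+1)%:R => N N0; field.
have cF : continuous (fun t : R => ((2 * t - 1) ^+ 2) ^+ k).
  move=> t; apply: is_derive_continuous (is_derive_exprn k (is_derive_exprn 2 (dA t))).
rewrite /Rintegral (@continuous_FTC2 _ _ F) //.
- rewrite /F mulr1 mulr0 sub0r /= (_ : 2 - 1 = 1); last by ring.
  rewrite expr1n -signr_odd /= odd_double expr1.
  by move: k0; move: (k.*2.+1)%:R => N N0; field.
- exact: continuous_subspaceT.
- split => [t _| |]; first by have [] := dF t.
    by apply: cvg_at_right_filter; exact: is_derive_continuous (dF 0).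
  by apply: cvg_at_left_filter; exact: is_derive_continuous (dF 1).
- by move=> t _; rewrite (derive1_is_derive dF).
Qed.

Lemma Rintegral_pow01_comb (R : realType) (b0 b1 b2 : R) k :
  \int[@lebesgue_measure R]_(t in `[0, 1])
    (b0 + (b1 * ((2 * t - 1) ^+ 2) ^+ k + b2 * ((2 * t - 1) ^+ 2) ^+ k.+1)) =
  b0 + (b1 / (k.*2.+1)%:R + b2 / (k.+1.*2.+1)%:R).
Proof.
have cY j : continuous (fun t : R => ((2 * t - 1) ^+ 2) ^+ j).
  move=> t; have dA : is_derive t 1 (fun t : R => 2 * t - 1) 2 by exact: is_derive_affine.
  exact: is_derive_continuous (is_derive_exprn j (is_derive_exprn 2 dA)).
have int j : (@lebesgue_measure R).-integrable `[0, 1]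
    (EFin \o (fun t : R => ((2 * t - 1) ^+ 2) ^+ j)).
  by apply: continuous_itv_integrable; apply: continuous_subspaceT; exact: cY.
have intZ (b : R) j : (@lebesgue_measure R).-integrable `[0, 1]
    (EFin \o (fun t : R => b * ((2 * t - 1) ^+ 2) ^+ j)).
  exact: integrable_Zl.
rewrite RintegralD //; [|exact: continuous_itv_integrable (continuous_subspaceT
  (@cst_continuous _ _ b0))|exact: (integrableD _ (intZ b1 k) (intZ b2 k.+1))].
rewrite RintegralD // !RintegralZl // !Rintegral_pow01.
by rewrite Rintegral_cst //= lebesgue_measure_itv /= lte01 sube0 /= mulr1.
Qed.

(** * Curves on the line *)

(** A supremum argument: the local bound shows that the set of points up to which
    the global bound holds contains its supremum and can be extended past it. *)
Lemma local_lipschitz (R : realType) (h : R -> R) (M : R) : 0 <= M ->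
  (forall t0, 0 <= t0 <= 1 -> exists2 r : R, 0 < r &
     forall t, 0 <= t <= 1 -> `|t - t0| < r -> `|h t - h t0| <= M * `|t - t0|) ->
  forall s t, 0 <= s -> s <= t -> t <= 1 -> `|h t - h s| <= M * (t - s).
Proof.
move=> M0 hloc s t s0 st t1.
pose S : set R := [set u | s <= u <= t /\ `|h u - h s| <= M * (u - s)].
have Ss : S s by split; [lra|rewrite !subrr normr0 mulr0].
have supS : has_sup S by split; [exists s|exists t => u [/andP[]]].
have Sle u : S u -> u <= sup S by exact: (sup_upper_bound supS).
have s_sup : s <= sup S by exact: Sle.
have sup_t : sup S <= t by apply: ge_sup; [exists s|move=> u [/andP[]]].
have [|r r0 hr] := hloc (sup S); first lra.
have Ssup : S (sup S).
  split; first lra.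
  have [u Su ur] := sup_adherent r0 supS.
  have [/andP[su _] hu] := Su; have us := Sle u Su.
  have := hr u; rewrite ler0_norm; last lra.
  move=> /(_ _ _)/wrap[]; [lra|lra|].
  have -> : h (sup S) - h s = (h u - h s) - (h u - h (sup S)) by ring.
  move=> hus; apply: le_trans (ler_normB _ _) _; move: hu hus.
  by move: (`|h u - h s|) (`|h u - h (sup S)|) => p q; lra.
move: sup_t; rewrite le_eqVlt => /predU1P[<-|sup_t]; first by have [] := Ssup.
pose v := Num.min t (sup S + r / 2).
have vt : v <= t by rewrite ge_min lexx.
have vr : v <= sup S + r / 2 by rewrite ge_min lexx orbT.
have vsup : sup S < v by rewrite lt_min sup_t ltrDl divr_gt0.
suff /Sle : S v by rewrite leNgt vsup.
split; first lra.
have := hr v; rewrite ger0_norm; last lra.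
move=> /(_ _ _)/wrap[]; [lra|lra|].
have [_ hs] := Ssup.
have -> : h v - h s = (h v - h (sup S)) + (h (sup S) - h s) by ring.
move=> hvs; apply: le_trans (ler_normD _ _) _; move: hs hvs.
by move: (`|h v - h (sup S)|) (`|h (sup S) - h s|) => p q; lra.
Qed.

Lemma exists_primitive (R : realType) (f : R -> R) (c d : R) : c < d ->
  (forall x, c <= x <= d -> {for x, continuous f}) ->
  exists F : R -> R, forall x : R, c < x < d -> is_derive x 1 F (f x).
Proof.
move=> cd cf; exists (fun x => \int[lebesgue_measure]_(t in `[c, x]) f t).
move=> x /andP[cx xd].
have intf : (@lebesgue_measure R).-integrable `[c, d] (EFin \o f).
  apply: continuous_itv_integrable; apply: continuous_in_subspaceT => y.
  by rewrite inE /= in_itv /=; exact: cf.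
have cfx : {for x, continuous f} by apply: cf; rewrite !ltW.
have [dF <-] := continuous_FTC1_closed xd intf cx cfx.
by rewrite derive1E; exact: derivableP.
Qed.

Section inverse_primitive.
Context {R : realType} {f F : R -> R} {c d : R}.
Hypothesis f_gt0 : forall x, c < x < d -> 0 < f x.
Hypothesis dF : forall x : R, c < x < d -> is_derive x 1 F (f x).

Lemma primitive_MVT x y : c < x -> x <= y -> y < d ->
  exists2 z, x <= z <= y & F y - F x = f z * (y - x).
Proof.
move=> cx xy yd.
have [z||z] := @MVT_segment R F f x y xy.
- by rewrite in_itv /= => /andP[xz zy]; apply: dF; lra.
- apply: derivable_within_continuous => z; rewrite in_itv /= => /andP[xz zy].
  by have [] : is_derive z 1 F (f z) by apply: dF; lra.
- by rewrite in_itv /=; exists z.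
Qed.

Lemma primitive_inj x y : c < x < d -> c < y < d -> F x = F y -> x = y.
Proof.
wlog xy : x y / x <= y.
  move=> H; have [xy|/ltW yx] := leP x y; first exact: H.
  by move=> xc yc /esym e; apply/esym; exact: H.
move=> /andP[cx xd] /andP[cy yd] Fxy; have [z zxy] := primitive_MVT cx xy yd.
rewrite Fxy subrr => /esym/eqP; rewrite mulf_eq0 gt_eqF; last by apply: f_gt0; lra.
by rewrite /= subr_eq0 => /eqP.
Qed.

(** The curve through [a] and [b] whose speed is inversely proportional to
    [f]: the inverse of the primitive, run affinely. *)
Lemma inverse_primitive a b : c < a -> a < b -> b < d ->
  exists X : R -> R, [/\ X 0 = a, X 1 = b & forall t : R, 0 <= t <= 1 ->
    [/\ a <= X t <= b, F (X t) = F a + (F b - F a) * t &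
        is_derive t 1 X ((F b - F a) / f (X t))]].
Proof.
move=> ca ab bd.
have ad : c < a < d by lra.
have bcd : c < b < d by lra.
pose G y := xget a [set z | c < z < d /\ F z = y].
have FK z : c < z < d -> G (F z) = z.
  move=> zcd; rewrite /G; case: xgetP => [y _ [ycd Fy]|/(_ z)/not_andP[]//].
  exact: primitive_inj.
pose X t := G (F a + (F b - F a) * t).
have X0 : X 0 = a by rewrite /X mulr0 addr0 FK.
have X1 : X 1 = b by rewrite /X mulr1 addrC subrK FK.
exists X; split=> // t t01.
have cF : {within `[a, b], continuous F}.
  apply: derivable_within_continuous => z; rewrite in_itv /= => zab.
  by have [] : is_derive z 1 F (f z) by apply: dF; lra.
have Fab : F a <= F b.
  have [z zab] := primitive_MVT ca (ltW ab) bd.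
  move/eqP; rewrite subr_eq => /eqP ->; rewrite lerDr mulr_ge0 ?subr_ge0 ?(ltW ab) //.
  by apply: ltW; apply: f_gt0; lra.
have [|z] := @IVT R F a b (F a + (F b - F a) * t) (ltW ab) cF.
  rewrite (min_idPl Fab) (max_idPr Fab).
  have := ler_wpM2l (_ : 0 <= F b - F a) (_ : t <= 1).
  have := mulr_ge0 (_ : 0 <= F b - F a) (_ : 0 <= t).
  rewrite subr_ge0 => /(_ Fab _)/wrap[]; first lra.
  by move=> h1 /(_ Fab _)/wrap[]; lra.
rewrite in_itv /= => zab Fz.
have zcd : c < z < d by lra.
have Xt : X t = z by rewrite /X -Fz FK.
rewrite Xt; split=> //.
have dG : is_derive (F z) 1 G (f z)^-1.
  apply: is_derive_inverse.
  - have : z \in `]c, d[ by rewrite in_itv.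
    move=> /near_in_itvoo; apply: filterS => y; rewrite in_itv /=; exact: FK.
  - have : z \in `]c, d[ by rewrite in_itv.
    move=> /near_in_itvoo; apply: filterS => y; rewrite in_itv /= => ycd.
    exact: is_derive_continuous (dF ycd).
  - exact: dF.
  - by rewrite gt_eqF // f_gt0.
have -> : X = (fun t => G ((F b - F a) * t + F a)) by apply/funext => u; rewrite /X addrC.
have := @is_derive1_comp _ G (fun t => (F b - F a) * t + F a) t (f z)^-1 (F b - F a).
rewrite [_ * t + _]addrC -Fz mulrC; apply => //.
exact: is_derive_affine.
Qed.

End inverse_primitive.

Lemma is_derive_local_lipschitz (R : realType) (F : R -> R) (x d e : R) :
  is_derive x 1 F d -> 0 < e -> exists2 r : R, 0 < r &
  forall y, `|y - x| < r -> `|F y - F x| <= (`|d| + e) * `|y - x|.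
Proof.
move=> /is_derive1_caratheodory[g [gE cg gx]] e0.
move: cg => /cvgrPdist_le /(_ e e0) /nbhs_ballP[r /= r0 hr]; exists r => // y yx.
rewrite gE normrM ler_wpM2r //.
have := hr y; rewrite /ball /= distrC => /(_ yx); rewrite gx => h.
by rewrite (_ : g y = d - (d - g y)); [rewrite (le_trans (ler_normB _ _)) // lerD2l|ring].
Qed.

Lemma clamp_lipschitz (R : realType) (a b x y : R) : a <= b -> a <= y <= b ->
  `|Num.max a (Num.min x b) - y| <= `|x - y|.
Proof.
move=> ab /andP[ay yb]; have [bx|/ltW xb] := leP b x.
  by rewrite (max_idPr ab) !ger0_norm ?lerB ?subr_ge0 // (le_trans yb).
have [xa|_] := leP x a; last by [].
by rewrite !ler0_norm ?lerN2 ?lerB ?subr_le0 // (le_trans xa).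
Qed.

(** * The duality bound *)

Section mean.
Context {R : realType} (L : R -> R -> R) (hL : admissible_mean L).

Lemma mean_diag a : 0 < a -> L a a = a.
Proof.
by move=> a0; rewrite -{1 2}(mulr1 a) (am_homogeneous hL) // (am_normalized hL) mulr1.
Qed.

Lemma mean_ge_min a s t : 0 < a -> a <= s -> a <= t -> a <= L s t.
Proof.
move=> a0 as_ at_; rewrite -{1}(mean_diag a0).
apply: le_trans (am_nondecreasing_l hL (ltW a0) as_ (ltW a0)) _.
by apply: (am_nondecreasing_r hL) => //; [exact: le_trans (ltW a0) as_|exact: ltW].
Qed.

Lemma mean_gt0 s t : 0 < s -> 0 < t -> 0 < L s t.
Proof.
move=> s0 t0; apply: (@lt_le_trans _ _ (Num.min s t)); first by rewrite lt_min s0.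
by apply: mean_ge_min; rewrite ?lt_min ?s0 // ge_min lexx // orbT.
Qed.

Lemma mean_le_max a s t : 0 < a -> 0 <= s -> s <= a -> 0 <= t -> t <= a -> L s t <= a.
Proof.
move=> a0 s0 sa t0 ta; rewrite -[leRHS](mean_diag a0).
apply: le_trans (am_nondecreasing_l hL s0 sa t0) _.
by apply: (am_nondecreasing_r hL) => //; exact: ltW.
Qed.

Lemma action_density_ge0 s t w : (0 <= action_density L s t w)%E.
Proof.
rewrite /action_density; case: ifPn => [/andP[s0 t0]|_]; last by case: ifPn.
by rewrite lee_fin divr_ge0 ?sqr_ge0 // ltW // mean_gt0.
Qed.

(** The action density is the Legendre transform in [w] of the quadratic form
    with coefficient [L s t]; this half of the duality holds also on the
    boundary, whatever value the density takes there. *)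
Lemma action_density_young s t w p : 0 <= s -> 0 <= t ->
  ((2 * w * p - L s t * p ^+ 2)%:E <= action_density L s t w)%E.
Proof.
move=> s0 t0; rewrite /action_density; case: ifPn => [/andP[s1 t1]|_].
  have L0 := mean_gt0 s1 t1.
  rewrite lee_fin ler_pdivlMr // -subr_ge0.
  rewrite (_ : _ - _ = (w - L s t * p) ^+ 2) ?sqr_ge0 //; ring.
case: ifPn => [/and3P[/eqP -> _ _]|_]; last by rewrite leey.
rewrite lee_fin mulr0 mul0r sub0r oppr_le0 mulr_ge0 ?sqr_ge0 //.
exact: (am_ge0 hL).
Qed.

Context {X : finType} (Q : X -> X -> R) (Q0 : forall x y, 0 <= Q x y).

Definition gradient_flux (psi : X -> R) (V : X -> X -> R) : R :=
  2^-1 * \sum_x \sum_y (psi y - psi x) * V x y.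

(** The quadratic form dual to the action: the squared norm of the gradient of
    [psi] in the Riemannian structure at [m]. *)
Definition mobility (m : X -> R) (psi : X -> R) : R :=
  2^-1 * \sum_x \sum_y L (m x * Q x y) (m y * Q y x) * (psi y - psi x) ^+ 2.

Lemma action_ge0 m V : (0 <= action L Q m V)%E.
Proof.
apply: mule_ge0; first by rewrite lee_fin invr_ge0.
by apply: sume_ge0 => x _; apply: sume_ge0 => y _; exact: action_density_ge0.
Qed.

Lemma action_young (m : X -> R) V psi c : (forall x, 0 <= m x) ->
  ((2 * c * gradient_flux psi V - c ^+ 2 * mobility m psi)%:E <= action L Q m V)%E.
Proof.
move=> m0; have -> : 2 * c * gradient_flux psi V - c ^+ 2 * mobility m psi =
    2^-1 * \sum_x \sum_y (2 * V x y * (c * (psi y - psi x)) -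
       L (m x * Q x y) (m y * Q y x) * (c * (psi y - psi x)) ^+ 2).
  rewrite /gradient_flux /mobility !mulrA [2 * c * _]mulrC [c ^+ 2 * _]mulrC -!mulrA.
  rewrite -mulrBr; congr (_ * _); rewrite !mulr_sumr -sumrB.
  apply: eq_bigr => x _; rewrite !mulr_sumr -sumrB; apply: eq_bigr => y _; ring.
rewrite /action EFinM lee_pmul2l // ?lte_fin ?invr_gt0 //.
rewrite -sumEFin; apply: lee_sum => x _; rewrite -sumEFin; apply: lee_sum => y _.
by apply: action_density_young; exact: mulr_ge0.
Qed.

Definition pairing (psi m : X -> R) : R := \sum_x psi x * m x.

(** Discrete integration by parts. *)
Lemma gradient_flux_divergence psi V :
  gradient_flux psi V = - \sum_x psi x * (2^-1 * \sum_y (V x y - V y x)).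
Proof.
rewrite /gradient_flux.
have -> : \sum_x \sum_y (psi y - psi x) * V x y =
    \sum_x \sum_y psi x * V y x - \sum_x \sum_y psi x * V x y.
  rewrite [X in _ = X - _]exchange_big /= -sumrB; apply: eq_bigr => x _.
  by rewrite -sumrB; apply: eq_bigr => y _; rewrite mulrBl.
rewrite -opprB mulrN; congr (- _); rewrite -sumrB mulr_sumr; apply: eq_bigr => x _.
by rewrite -sumrB mulrCA; congr (_ * _); rewrite mulr_sumr; apply: eq_bigr => y _; ring.
Qed.

Notation mes := (@lebesgue_measure R).

Section lower.
Context {m0 m1 : X -> R} {mu : R -> X -> R} {V : R -> X -> X -> R}.
Hypothesis ce : CE1 m0 m1 mu V.

Let cmu x : {within `[0, 1], continuous (fun t => mu t x)}.
Proof. exact: (ce_continuous ce). Qed.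

Let intV x y : mes.-integrable `[0, 1] (EFin \o (fun t => V t x y)).
Proof.
by apply: (ce_integrable ce) => //; exact: segment_compact.
Qed.

Lemma pairing_continuous psi : {within `[0, 1], continuous (fun t => pairing psi (mu t))}.
Proof.
move=> t; apply: cvg_big => [|x _]; first exact: add_continuous.
by apply: cvgM; [exact: cvg_cst|exact: cmu].
Qed.

Lemma integrable_mulC (phi f : R -> R) : continuous phi ->
  mes.-integrable `[0, 1] (EFin \o f) ->
  mes.-integrable `[0, 1] (EFin \o (fun t => phi t * f t)).
Proof.
move=> cphi intf.
have c01 : {within `[0, 1], continuous phi} by exact: continuous_subspaceT.
apply: (@integrableMr _ _ _ mes `[0, 1] _ phi (EFin \o f)) => //.
  exact: subspace_continuous_measurable_fun.
have /compact_bounded := continuous_compact c01 (@segment_compact R 0 1).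
move=> [M [Mr HM]]; exists M; split=> // x Mx y y01.
by apply: HM => //; exists y.
Qed.

Let integrable_oo (f : R -> R) :
  mes.-integrable `[0, 1] (EFin \o f) -> mes.-integrable `]0, 1[ (EFin \o f).
Proof.
by apply: integrableS => //; apply: subset_itv; rewrite bnd_simp.
Qed.

Lemma test_function_continuous (phi : R -> R) : test_function phi ->
  continuous phi /\ continuous (derive1 phi).
Proof.
move=> [sphi _]; split=> x; apply/differentiable_continuous/derivable1_diffP.
  exact: (sphi 0%N).
exact: (sphi 1%N).
Qed.

Let intdiv x :
  mes.-integrable `[0, 1] (EFin \o (fun t => 2^-1 * \sum_y (V t x y - V t y x))).
Proof.
apply: integrable_Zl => //; apply: integrable_Rsum => // y.
exact: (integrableB _ (intV x y) (intV y x)).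
Qed.

Lemma weak_pairing psi phi : test_function phi ->
  - (\int[mes]_(t in `]0, 1[) (derive1 phi t * pairing psi (mu t))) =
  \int[mes]_(t in `]0, 1[) (phi t * gradient_flux psi (V t)).
Proof.
move=> tphi; have [cphi cdphi] := test_function_continuous tphi.
have -> : (fun t => derive1 phi t * pairing psi (mu t)) =
    (fun t => \sum_x psi x * (derive1 phi t * mu t x)).
  by apply/funext => t; rewrite mulr_sumr; apply: eq_bigr => x _; rewrite mulrCA.
have -> : (fun t => phi t * gradient_flux psi (V t)) =
    (fun t => \sum_x - psi x * (phi t * (2^-1 * \sum_y (V t x y - V t y x)))).
  apply/funext => t; rewrite gradient_flux_divergence mulrN mulr_sumr -sumrN.
  by apply: eq_bigr => x _; rewrite mulNr; congr (- _); rewrite mulrCA.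
have int1 x : mes.-integrable `]0, 1[ (EFin \o (fun t => derive1 phi t * mu t x)).
  apply: integrable_oo; apply: integrable_mulC => //.
  exact: continuous_itv_integrable.
have int2 x : mes.-integrable `]0, 1[
    (EFin \o (fun t => phi t * (2^-1 * \sum_y (V t x y - V t y x)))).
  by apply: integrable_oo; exact: integrable_mulC.
rewrite !Rintegral_sum //; [|by move=> x; exact: integrable_Zl..].
rewrite -sumrN; apply: eq_bigr => x _; rewrite !RintegralZl //.
rewrite mulNr; congr (- (_ * _)); apply/eqP.
by rewrite -subr_eq0 -oppr_eq0 opprB addrC; apply/eqP; exact: (ce_equation ce).
Qed.

Lemma integrable_flux psi :
  mes.-integrable `[0, 1] (EFin \o (fun t => gradient_flux psi (V t))).
Proof.
apply: integrable_Zl => //; apply: integrable_Rsum => // x.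
by apply: integrable_Rsum => // y; exact: integrable_Zl.
Qed.

Let near01 (M : R -> R) (u e : R) : {within `[0, 1], continuous M} -> 0 < u -> u < 1 ->
  0 < e -> exists2 d : R, 0 < d & forall x : R, u <= x <= u + d -> `|M u - M x| <= e.
Proof.
move=> cM u0 u1 e0.
have : {for u, continuous M}.
  have := (continuous_within_itvP M (ltr01 : 0 < 1)).1 cM => -[+ _ _].
  by apply; rewrite in_itv /= u0.
move=> /cvgrPdist_le /(_ e e0) /nbhs_ballP[d /= d0 dM].
exists (d / 2); first by rewrite divr_gt0.
move=> x ux; apply: dM; rewrite /ball /= ltr_norml; lra.
Qed.

(** Testing the continuity equation against a cutoff of [s, t] and applying
    the duality inequality bounds increments of linear observables by the
    action, although the velocity field is merely integrable. *)
Lemma pairing_increment psi (B c s t : R) : 0 <= c -> 0 <= B ->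
  (forall u, 0 <= u <= 1 -> mobility (mu u) psi <= B) ->
  0 < s -> s <= t -> t < 1 ->
  ((2 * c * (pairing psi (mu t) - pairing psi (mu s)) - c ^+ 2 * B)%:E <=
   \int[mes]_(u in `[0%R, 1%R]) action L Q (mu u) (V u))%E.
Proof.
move=> c0 B0 HB s0 st t1; apply/lee_addgt0Pr => e e0.
pose e1 := e / (4 * c + 1).
have e10 : 0 < e1 by rewrite divr_gt0 // ltr_wpDl // mulr_ge0.
have cM := @pairing_continuous psi.
have [d1 d10 dM1] := near01 cM s0 (le_lt_trans st t1) e10.
have [d2 d20 dM2] := near01 cM (lt_le_trans s0 st) t1 e10.
pose d := Num.min (Num.min d1 d2) ((1 - t) / 2).
have d0 : 0 < d by rewrite !lt_min d10 d20 divr_gt0 // subr_gt0.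
have dd1 : d <= d1 by rewrite !ge_min lexx.
have dd2 : d <= d2 by rewrite !ge_min lexx orbT.
have dt : d <= (1 - t) / 2 by rewrite ge_min lexx orbT.
have [|phi [tphi phi01 hphi]] := cutoff s0 st d0; first lra.
have [cphi _] := test_function_continuous tphi.
have := hphi _ (pairing psi (mu s) + e1) (pairing psi (mu t) - e1) cM.
rewrite (weak_pairing psi tphi) => /(_ _ _)/wrap[].
  by move=> x xs; have := dM1 x; rewrite ler_norml => /(_ _)/wrap[]; lra.
  by move=> x xs; have := dM2 x; rewrite ler_norml => /(_ _)/wrap[]; lra.
set J := \int[_]_(_ in _) _ => hJ.
have intJ : mes.-integrable `]0, 1[
    (EFin \o (fun t => phi t * gradient_flux psi (V t))).
  apply: integrable_oo; apply: integrable_mulC => //; exact: integrable_flux.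
have intphi : mes.-integrable `]0, 1[ (EFin \o phi).
  by apply: integrable_oo; apply: continuous_itv_integrable; exact: continuous_subspaceT.
have intE : mes.-integrable `]0, 1[ (EFin \o
    (fun t => 2 * c * (phi t * gradient_flux psi (V t)) - c ^+ 2 * B * phi t)).
  have I1 : mes.-integrable `]0, 1[
      (EFin \o (fun t => 2 * c * (phi t * gradient_flux psi (V t)))).
    exact: integrable_Zl.
  have I2 : mes.-integrable `]0, 1[ (EFin \o (fun t => c ^+ 2 * B * phi t)).
    exact: integrable_Zl.
  exact: (integrableB _ I1 I2).
have phi1 : \int[mes]_(x in `]0, 1[) phi x <= 1.
  apply: (@le_trans _ _ (\int[mes]_(x in `]0, 1[) cst 1 x)).
    apply: le_Rintegral => //; last by move=> x _; have /andP[] := phi01 x.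
    apply: integrable_oo; apply: continuous_itv_integrable.
    by apply: continuous_subspaceT; exact: cst_continuous.
  by rewrite Rintegral_cst // mul1r /= lebesgue_measure_itv /= lte01 sube0.
have /(_ _ _ _ _)/wrap[] := @Rintegral_le_integral _ _ R mes _ `[0, 1] _
  (fun u => action L Q (mu u) (V u)) _ _ intE.
  exact: measurable_itv.
  by apply: subset_itv; rewrite bnd_simp.
  by move=> x _; exact: action_ge0.
  move=> x; rewrite /= in_itv /= => /andP[x0 x1].
  have x01 : 0 <= x <= 1 by rewrite !ltW.
  have [mux _] := ce_prob ce x01.
  have /andP[p0 p1] := phi01 x.
  have : (((phi x) * (2 * c * gradient_flux psi (V x) - c ^+ 2 * mobility (mu x) psi))%:E
     <= action L Q (mu x) (V x))%E.
    apply: (@le_trans _ _ ((phi x)%:E * action L Q (mu x) (V x)))%E.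
      by rewrite EFinM lee_wpmul2l // action_young.
    by rewrite -[leRHS]mul1e lee_wpmul2r ?lee_fin // action_ge0.
  apply: le_trans; rewrite lee_fin.
  have := ler_wpM2l p0 (ler_wpM2l (sqr_ge0 c) (HB x x01)); lra.
rewrite RintegralB //; [|exact: integrable_Zl..].
rewrite !RintegralZl // -/J => hA.
apply: le_trans (leeD hA (lexx e%:E)); rewrite -EFinD lee_fin.
have h1 := ler_wpM2l (mulr_ge0 (sqr_ge0 c) B0) phi1.
have h2 := ler_wpM2l c0 hJ.
have h3 : 4 * c * e1 <= e.
  rewrite /e1 mulrCA ler_piMr ?(ltW e0) // ler_pdivrMr ?mul1r ?lerDl //.
  by rewrite ltr_wpDl // mulr_ge0.
move: h1 h2 h3; move: (\int[_]_(_ in _) _) => I1.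
by clear; move: (pairing _ _) (pairing _ _) => p q; lra.
Qed.

End lower.
End mean.

(** * Bounds on the transport distance *)

Section distance.
Context {R : realType} (L : R -> R -> R) (hL : admissible_mean L).
Context {X : finType} (Q : X -> X -> R) (Q0 : forall x y, 0 <= Q x y).
Notation mes := (@lebesgue_measure R).

Lemma transport_dist_ge (m0 m1 : X -> R) (a : R) :
  (forall mu V A, CE1 m0 m1 mu V -> 0 <= A ->
    (\int[mes]_(t in `[0%R, 1%R]) action L Q (mu t) (V t) <= A%:E)%E ->
    a <= Num.sqrt A) ->
  (a%:E <= transport_dist L Q m0 m1)%E.
Proof.
move=> H; apply: le_ereal_inf_tmp => _ [mu [V [ce ->]]].
set I := (\int[_]_(_ in _) _)%E.
have I0 : (0 <= I)%E by apply: integral_ge0 => t _; exact: action_ge0.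
case EI : I I0 => [A| |] //= A0; last by rewrite leey.
by rewrite lee_fin; apply: (H mu V) => //; rewrite -/I EI.
Qed.

Lemma transport_dist_le (m0 m1 : X -> R) mu V (A : R) :
  CE1 m0 m1 mu V ->
  (\int[mes]_(t in `[0%R, 1%R]) action L Q (mu t) (V t) <= A%:E)%E ->
  (transport_dist L Q m0 m1 <= (Num.sqrt A)%:E)%E.
Proof.
set I := (\int[_]_(_ in _) _)%E => ce IA.
have I0 : (0 <= I)%E by apply: integral_ge0 => t _; exact: action_ge0.
apply: (@le_trans _ _ (sqrte I)).
  by apply: ereal_inf_lbound; exists mu, V.
case EI : I I0 IA => [B| |] //= B0; rewrite !lee_fin => BA.
exact: ler_wsqrtr.
Qed.

Lemma quadratic_bound (D A B : R) : 0 < B -> 0 <= D ->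
  (forall c, 0 <= c -> 2 * c * D - c ^+ 2 * B <= A) -> D ^+ 2 <= B * A.
Proof.
move=> B0 D0 /(_ (D / B)); rewrite divr_ge0 ?(ltW B0) // => /(_ isT).
have -> : 2 * (D / B) * D - (D / B) ^+ 2 * B = D ^+ 2 / B by field; rewrite gt_eqF.
by rewrite ler_pdivrMr // mulrC.
Qed.

Lemma mobilityN m (psi : X -> R) : mobility L Q m (fun x => - psi x) =
  mobility L Q m psi.
Proof.
congr (_ * _); apply: eq_bigr => x _; apply: eq_bigr => y _; congr (_ * _); ring.
Qed.

Lemma pairingN (m psi : X -> R) : pairing (fun x => - psi x) m = - pairing psi m.
Proof. by rewrite /pairing -sumrN; apply: eq_bigr => x _; rewrite mulNr. Qed.

Section curve.
Context {m0 m1 : X -> R} {mu : R -> X -> R} {V : R -> X -> X -> R} {A : R}.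
Hypothesis ce : CE1 m0 m1 mu V.
Hypothesis IA : (\int[mes]_(t in `[0%R, 1%R]) action L Q (mu t) (V t) <= A%:E)%E.

Let pairing_increment_closed psi (B c s t : R) : 0 <= c -> 0 <= B ->
  (forall u, 0 <= u <= 1 -> mobility L Q (mu u) psi <= B) ->
  0 <= s -> s < t -> t <= 1 ->
  2 * c * (pairing psi (mu t) - pairing psi (mu s)) - c ^+ 2 * B <= A.
Proof.
move=> c0 B0 HB s0 st t1; apply/ler_addgt0Pr => e e0.
pose e1 := e / (4 * c + 1).
have e10 : 0 < e1 by rewrite divr_gt0 // ltr_wpDl // mulr_ge0.
have near_in u : 0 <= u <= 1 -> exists2 d : R, 0 < d & forall x, 0 <= x <= 1 ->
    `|u - x| < d -> `|pairing psi (mu u) - pairing psi (mu x)| <= e1.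
  move=> u01; have /subspace_continuousP := @pairing_continuous _ _ _ _ _ _ ce psi.
  move=> /(_ u); rewrite /= in_itv /= => /(_ u01) /cvgrPdist_le /(_ e1 e10).
  rewrite near_withinE => /nbhs_ballP[d /= d0 dM]; exists d => // x x01 ux.
  by apply: dM => //; rewrite in_itv.
have [|d1 d10 h1] := near_in s; first lra.
have [|d2 d20 h2] := near_in t; first lra.
pose d := Num.min (Num.min d1 d2) (t - s) / 3.
have d0 : 0 < d by rewrite divr_gt0 // !lt_min d10 d20 subr_gt0.
have dd1 : 3 * d <= d1 by rewrite /d mulrC divfK // !ge_min lexx.
have dd2 : 3 * d <= d2 by rewrite /d mulrC divfK // !ge_min lexx orbT.
have dt : 3 * d <= t - s by rewrite /d mulrC divfK // ge_min lexx orbT.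
have := @pairing_increment _ _ hL _ _ Q0 _ _ _ _ ce psi B c (s + d) (t - d) c0 B0 HB.
move=> /(_ _ _ _)/wrap[]; [lra|lra|lra|move=> /le_trans/(_ IA)].
rewrite lee_fin => h3.
have {}h1 : `|pairing psi (mu s) - pairing psi (mu (s + d))| <= e1.
  by apply: h1; [lra|rewrite opprD addrA subrr sub0r normrN gtr0_norm; lra].
have {}h2 : `|pairing psi (mu t) - pairing psi (mu (t - d))| <= e1.
  by apply: h2; [lra|rewrite opprB addrC addrNK gtr0_norm; lra].
have h4 : 4 * c * e1 <= e.
  rewrite /e1 mulrCA ler_piMr ?(ltW e0) // ler_pdivrMr ?mul1r ?lerDl //.
  by rewrite ltr_wpDl // mulr_ge0.
have h5 : pairing psi (mu t) - pairing psi (mu s) <=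
    pairing psi (mu (t - d)) - pairing psi (mu (s + d)) + 2 * e1.
  by move: h1 h2; rewrite !ler_norml; lra.
have h6 := ler_wpM2l c0 h5.
move: h3 h4 h6; clear; move: (pairing _ (mu (t - d))) (pairing _ (mu (s + d))).
by move: (pairing _ _) (pairing _ _) => *; lra.
Qed.

(** The previous bound with the best [c]. *)
Lemma pairing_increment_sqr psi (B s t : R) : 0 < B ->
  (forall u, 0 <= u <= 1 -> mobility L Q (mu u) psi <= B) ->
  0 <= s -> s <= t -> t <= 1 -> 0 <= A ->
  (pairing psi (mu t) - pairing psi (mu s)) ^+ 2 <= B * A.
Proof.
move=> B0 HB s0; rewrite le_eqVlt => /predU1P[-> _ A0|st t1 A0].
  by rewrite subrr expr0n mulr_ge0 // ltW.
have [D0|D0] := leP 0 (pairing psi (mu t) - pairing psi (mu s)).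
  by apply: quadratic_bound => // c c0; apply: pairing_increment_closed => //; exact: ltW.
rewrite -sqrrN; apply: quadratic_bound => //; first by rewrite oppr_ge0 ltW.
move=> c c0; rewrite (_ : - (_ - _) = pairing (fun x => - psi x) (mu t) -
    pairing (fun x => - psi x) (mu s)); last by rewrite !pairingN opprB opprK addrC.
apply: pairing_increment_closed => //.
  exact: ltW.
by move=> u u01; rewrite mobilityN; exact: HB.
Qed.

Definition rate_bound : R := 1 + \sum_x \sum_y Q x y.

Lemma rate_boundP x y : Q x y <= rate_bound.
Proof.
rewrite /rate_bound (bigD1 x) //= (bigD1 y) //=.
set a := \sum_(_ | _) _; set b := \sum_(_ | _) _.
have a0 : 0 <= a by rewrite sumr_ge0.
have b0 : 0 <= b by rewrite sumr_ge0 // => z _; rewrite sumr_ge0.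
lra.
Qed.

Lemma rate_bound_gt0 : 0 < rate_bound.
Proof.
by rewrite ltr_pwDl // sumr_ge0 // => x _; rewrite sumr_ge0.
Qed.

Lemma prob_le1 (m : X -> R) x : is_prob m -> m x <= 1.
Proof.
move=> [m_ge0 <-]; rewrite (bigD1 x) //= lerDl sumr_ge0 //.
Qed.

(** A crude bound for the mobility of the indicator of a point, uniform over
    probability measures. *)
Definition speed_bound : R := 2^-1 * \sum_(x : X) \sum_(y : X) rate_bound + 1.

Lemma speed_bound_gt0 : 0 < speed_bound.
Proof.
rewrite ltr_wpDl // mulr_ge0 ?invr_ge0 // sumr_ge0 // => x _.
by rewrite sumr_ge0 // => y _; exact: ltW rate_bound_gt0.
Qed.

Lemma mobility_indicator (m : X -> R) z : is_prob m ->
  mobility L Q m (fun x => (x == z)%:R) <= speed_bound.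
Proof.
move=> pm; apply: (@le_trans _ _ (2^-1 * \sum_(x : X) \sum_(y : X) rate_bound)).
  rewrite ler_wpM2l ?invr_ge0 //; apply: ler_sum => x _; apply: ler_sum => y _.
  have mQ a b : 0 <= m a * Q a b <= rate_bound.
    have [m_ge0 _] := pm; rewrite mulr_ge0 //=; apply: le_trans (rate_boundP a b).
    by rewrite ler_piMl // prob_le1.
  have /andP[a1 a2] := mQ x y; have /andP[b1 b2] := mQ y x.
  have Lb := mean_le_max hL rate_bound_gt0 a1 a2 b1 b2.
  have L0 := am_ge0 hL a1 b1.
  case: (y == z) (x == z) => -[];
    rewrite ?subrr ?subr0 ?sub0r ?sqrrN expr2 ?mul0r ?mulr0 ?mulr1 //;
    exact: ltW rate_bound_gt0.
by rewrite /speed_bound lerDl.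
Qed.

Lemma pairing_indicator (m : X -> R) z : pairing (fun x => (x == z)%:R) m = m z.
Proof.
rewrite /pairing (bigD1 z) //= eqxx mul1r big1 ?addr0 // => x /negPf ->.
by rewrite mul0r.
Qed.

Lemma coordinate_increment z (t : R) : 0 <= t <= 1 -> 0 <= A ->
  (mu t z - m0 z) ^+ 2 <= speed_bound * A.
Proof.
move=> /andP[t0 t1] A0; rewrite -(ce_start ce) -!(pairing_indicator _ z).
apply: pairing_increment_sqr => //; first exact: speed_bound_gt0.
by move=> u u01; apply: mobility_indicator; exact: (ce_prob ce).
Qed.

End curve.

(** The distance controls each coordinate; this is what keeps short curves near
    their starting point, and makes geodesics continuous. *)
Lemma transport_dist_coordinate (m0 m1 : X -> R) z :
  ((`|m1 z - m0 z| / Num.sqrt speed_bound)%:E <= transport_dist L Q m0 m1)%E.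
Proof.
apply: transport_dist_ge => mu V A ce A0 IA.
rewrite ler_pdivrMr ?sqrtr_gt0 ?speed_bound_gt0 //.
rewrite -sqrtr_sqr -sqrtrM // ler_wsqrtr // mulrC.
have := coordinate_increment ce IA z (t := 1); rewrite (ce_end ce).
by apply=> //; rewrite ler01 lexx.
Qed.

End distance.

(** For differentiable curves the weak equation is an integration by parts
    against a test function that vanishes at both ends. *)
Lemma CE1_of_derivative (R : realType) (X : finType) (nu dnu : R -> X -> R)
    (V : R -> X -> X -> R) :
  (forall t, 0 <= t <= 1 -> is_prob (nu t)) ->
  (forall x (t : R), 0 <= t <= 1 -> is_derive t 1 (fun u => nu u x) (dnu t x)) ->
  (forall x y, {within `[0, 1], continuous (fun t => V t x y)}) ->
  (forall x t, 0 <= t <= 1 ->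
     dnu t x = - (2^-1 * \sum_y (V t x y - V t y x))) ->
  CE1 (nu 0) (nu 1) nu V.
Proof.
move=> pnu Dnu cV eqn.
have cdiv x : {within `[0, 1], continuous (fun t => 2^-1 * \sum_y (V t x y - V t y x))}.
  move=> t; apply: cvgM; first exact: cvg_cst.
  apply: cvg_big => [|y _]; first exact: add_continuous.
  by apply: cvgB; exact: cV.
have lin x : {within `[0, 1],
    continuous (fun t => - (2^-1 * \sum_y (V t x y - V t y x)))}.
  by move=> t; apply: cvgN; exact: cdiv.
have cnu x : {within `[0, 1], continuous (fun t => nu t x)}.
  apply: derivable_within_continuous => t; rewrite in_itv /= => t01.
  by have [] := Dnu x t t01.
split=> //.
  move=> x y K K01 cK; apply: integrableS (continuous_itv_integrable (cV x y)) => //.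
  exact: compact_measurable.
move=> x phi tphi; have [a [b [a0 b1 phi0]]] := tphi.2.
have [cphi cdphi] := test_function_continuous tphi.
pose div t := 2^-1 * \sum_y (V t x y - V t y x).
have w01 (f : R -> R) : continuous f -> {within `[0, 1], continuous f}.
  exact: continuous_subspaceT.
have int (f g : R -> R) :
    {within `[0, 1], continuous f} -> {within `[0, 1], continuous g} ->
    (@lebesgue_measure R).-integrable `[0, 1] (EFin \o (fun t => f t * g t)).
  by move=> cf cg; apply: continuous_itv_integrable; exact: within_continuousM.
have I1 := int _ _ (w01 _ cdphi) (cnu x).
have I2 := int _ _ (w01 _ cphi) (cdiv x).
have I3 := int _ _ (w01 _ cphi) (lin x).
rewrite !Rintegral_oo01 //.
have := @Rintegration_by_parts R phi (fun t => nu t x) (derive1 phi) (fun t => - div t)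
  0 1 ltr01 (w01 _ cdphi).
move=> /(_ _ _ _ _ _)/wrap[].
- split => [t _| |]; first exact: (tphi.1 0%N).
    by apply: cvg_at_right_filter; exact: cphi.
  by apply: cvg_at_left_filter; exact: cphi.
- by [].
- exact: lin.
- split => [t| |].
  + rewrite in_itv /= => /andP[t0 t1].
    by have [] : is_derive t 1 (fun u => nu u x) (dnu t x) by apply: Dnu; rewrite !ltW.
  + apply: cvg_at_right_filter; apply: is_derive_continuous (Dnu x 0 _).
    by rewrite lexx ler01.
  + apply: cvg_at_left_filter; apply: is_derive_continuous (Dnu x 1 _).
    by rewrite lexx ler01.
- move=> t; rewrite in_itv /= => /andP[t0 t1]; rewrite derive1E.
  have t01 : 0 <= t <= 1 by rewrite !ltW.
  by have [_ ->] := Dnu x t t01; rewrite eqn.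
rewrite (phi0 0) ?(phi0 1); [|by right|by left].
rewrite !mul0r subrr sub0r => <-; rewrite -RintegralD //.
by under eq_Rintegral do rewrite mulrN addNr; rewrite Rintegral_cst // mul0r.
Qed.

(** * The edge of the triangle *)

Lemma sum3 (R : realType) (F : 'I_3 -> R) : \sum_x F x = F pt1 + F pt2 + F pt3.
Proof.
rewrite !big_ord_recl big_ord0 addr0 addrA; congr (_ + _ + _); congr F; exact: val_inj.
Qed.

Lemma pt_cases (x : 'I_3) : [\/ x = pt1, x = pt2 | x = pt3].
Proof.
case: x => [[|[|[|//]]] ?]; [constructor 1|constructor 2|constructor 3]; exact: val_inj.
Qed.

Definition edge (R : realType) (x : R) (z : 'I_3) : R :=
  if z == pt1 then 1 - x else if z == pt2 then x else 0.

Definition lifted_edge_potential (R : realType) (th : R) (z : 'I_3) : R :=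
  if z == pt1 then 0 else if z == pt2 then 1 else th.

Lemma is_prob_edge (R : realType) (x : R) : 0 <= x <= 1 -> is_prob (edge x).
Proof.
move=> /andP[x0 x1]; split=> [z|]; last by rewrite sum3 /edge /= addr0 subrK.
by rewrite /edge; case: ifP; rewrite ?subr_ge0 //; case: ifP.
Qed.

(** Antisymmetric, with [p] flowing from the first point to the second, [q] from
    the first to the third and [r] from the third to the second. *)
Definition flow3 (R : realType) (p q r : R) (x y : 'I_3) : R :=
  if x == pt1 then (if y == pt2 then p else if y == pt3 then q else 0)
  else if x == pt2 then (if y == pt1 then - p else if y == pt3 then - r else 0)
  else (if y == pt1 then - q else if y == pt2 then r else 0).

Lemma esum3 (R : realType) (F : 'I_3 -> \bar R) :
  (\sum_x F x = F pt1 + F pt2 + F pt3)%E.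
Proof.
rewrite !big_ord_recl big_ord0 adde0 addeA.
by congr (_ + _ + _)%E; congr F; exact: val_inj.
Qed.

Section three_points.
Context {R : realType} (L : R -> R -> R) (hL : admissible_mean L).
Context (Q : 'I_3 -> 'I_3 -> R) (Qge0 : forall x y, 0 <= Q x y).
Hypothesis Qgt0 : forall x y, x != y -> 0 < Q x y.
Notation mes := (@lebesgue_measure R).

Let q12 : 0 < Q pt1 pt2. Proof. exact: Qgt0. Qed.
Let q21 : 0 < Q pt2 pt1. Proof. exact: Qgt0. Qed.
Let q13 : 0 < Q pt1 pt3. Proof. exact: Qgt0. Qed.
Let q31 : 0 < Q pt3 pt1. Proof. exact: Qgt0. Qed.
Let q23 : 0 < Q pt2 pt3. Proof. exact: Qgt0. Qed.
Let q32 : 0 < Q pt3 pt2. Proof. exact: Qgt0. Qed.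

Lemma mean00 : L 0 0 = 0.
Proof.
have := am_homogeneous hL (ltr0n R 2) (lexx 0) (lexx 0).
rewrite mulr0; lra.
Qed.

Lemma mean0l t : 0 <= t -> L 0 t = t * L 0 1.
Proof.
rewrite le_eqVlt => /predU1P[<-|t0]; first by rewrite mean00 mul0r.
by rewrite -[in LHS](mulr0 t) -[X in L _ X]mulr1 (am_homogeneous hL).
Qed.

Lemma mean0r s : 0 <= s -> L s 0 = s * L 0 1.
Proof. by move=> s0; rewrite (am_sym hL) // mean0l. Qed.

(** Up to the factor [L 0 1], the conductance of the two edges at the empty third
    vertex connected in series: the inverse of
    [1 / ((1 - x) * Q13) + 1 / (x * Q23)]. *)
Definition detour (x : R) : R :=
  x * (1 - x) * Q pt1 pt3 * Q pt2 pt3 / ((1 - x) * Q pt1 pt3 + x * Q pt2 pt3).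

(** The effective conductance at [edge x]: direct edge and detour in parallel. *)
Definition conductance (x : R) : R :=
  L ((1 - x) * Q pt1 pt2) (x * Q pt2 pt1) + L 0 1 * detour x.

Notation C := conductance.
Notation g := detour.

(** The value at the third vertex of the harmonic extension of the values 0 and 1
    at the first two, with the mobilities of [edge x] as weights. *)
Definition harmonic_value (x : R) : R :=
  x * Q pt2 pt3 / ((1 - x) * Q pt1 pt3 + x * Q pt2 pt3).

Lemma mobility3 (m : 'I_3 -> R) th : (forall z, 0 <= m z) ->
  mobility L Q m (lifted_edge_potential th) =
  L (m pt1 * Q pt1 pt2) (m pt2 * Q pt2 pt1) +
  th ^+ 2 * L (m pt1 * Q pt1 pt3) (m pt3 * Q pt3 pt1) +
  (1 - th) ^+ 2 * L (m pt2 * Q pt2 pt3) (m pt3 * Q pt3 pt2).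
Proof.
move=> m0; rewrite /mobility !sum3 /lifted_edge_potential /=.
rewrite (am_sym hL (s := m pt2 * _) (t := m pt1 * _)) ?mulr_ge0 //.
rewrite (am_sym hL (s := m pt3 * _) (t := m pt1 * _)) ?mulr_ge0 //.
rewrite (am_sym hL (s := m pt3 * _) (t := m pt2 * _)) ?mulr_ge0 //.
by field.
Qed.

(** The Dirichlet energy of the harmonic extension is the effective
    conductance. *)
Lemma mobility_edge x : 0 < x -> x < 1 ->
  mobility L Q (edge x) (lifted_edge_potential (harmonic_value x)) =
  conductance x.
Proof.
move=> x0 x1; have [e0 _] : is_prob (edge x) by apply: is_prob_edge; lra.
rewrite mobility3 // /edge /= !mul0r !mean0r ?mulr_ge0 ?subr_ge0 ?ltW //.
rewrite /conductance /detour /harmonic_value; field.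
rewrite gt_eqF // addr_gt0 // mulr_gt0 // subr_gt0 //.
Qed.

Lemma mean_upper_near s t e : 0 <= s -> 0 <= t -> 0 < e -> exists2 d : R, 0 < d &
  forall s' t', 0 <= s' -> 0 <= t' -> `|s - s'| <= d -> `|t - t'| <= d ->
    L s' t' <= L s t + e.
Proof.
move=> s0 t0 e0; have /subspace_continuousP := am_continuous hL.
move=> /(_ (s, t)) /= /(_ (conj s0 t0)) /cvgrPdist_le /(_ e e0).
rewrite near_withinE => /nbhs_ballP[d /= d0 dL].
exists (d / 2); first by rewrite divr_gt0.
move=> s' t' s'0 t'0 ss tt.
have := dL (s', t') _ (conj s'0 t'0); move=> /(_ _)/wrap[]; first last.
  rewrite /from_subspace /= ler_norml; lra.
by split; rewrite /ball /=; [apply: le_lt_trans ss _|apply: le_lt_trans tt _]; lra.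
Qed.

(** Near the edge the mobility is hardly larger than the conductance, so that
    the linear observable with the harmonic value at the third vertex is
    almost a calibration of the edge; short curves stay near their starting
    point, by the crude coordinate bound. *)
Lemma edge_dist_lower x0 M : 0 < x0 -> x0 < 1 -> conductance x0 < M ->
  exists2 r : R, 0 < r & forall x, `|x - x0| < r ->
    ((`|x - x0| / Num.sqrt M)%:E <= transport_dist L Q (edge x0) (edge x))%E.
Proof.
move=> x00 x01 cM; pose th := harmonic_value x0.
have [e0 _] : is_prob (edge x0) by apply: is_prob_edge; lra.
have M0 : 0 < M.
  apply: le_lt_trans cM; rewrite -mobility_edge // mobility3 //.
  by do ?[exact: sqr_ge0|exact: e0|exact: Qge0|apply: (am_ge0 hL)|apply: addr_ge0
         |apply: mulr_ge0].
pose K := rate_bound Q; have K0 : 0 < K by exact: rate_bound_gt0.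
pose e := (M - conductance x0) / (1 + th ^+ 2 + (1 - th) ^+ 2).
have den0 : 0 < 1 + th ^+ 2 + (1 - th) ^+ 2.
  by rewrite -addrA ltr_pwDl // addr_ge0 ?sqr_ge0.
have ep : 0 < e by rewrite divr_gt0 // subr_gt0.
have pr z w : 0 <= edge x0 z * Q z w by rewrite mulr_ge0.
have [d12 d12p h12] := mean_upper_near (pr pt1 pt2) (pr pt2 pt1) ep.
have [d13 d13p h13] := mean_upper_near (pr pt1 pt3) (pr pt3 pt1) ep.
have [d23 d23p h23] := mean_upper_near (pr pt2 pt3) (pr pt3 pt2) ep.
pose d := Num.min (Num.min d12 d13) d23 / K.
have d0 : 0 < d by rewrite divr_gt0 // !lt_min d12p d13p.
have dK : d * K = Num.min (Num.min d12 d13) d23 by rewrite divfK // gt_eqF.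
have near_mob m : is_prob m -> (forall z, `|m z - edge x0 z| <= d) ->
    mobility L Q m (lifted_edge_potential th) <= M.
  move=> [m0 _] md; rewrite mobility3 //.
  have mQ z w : `|edge x0 z * Q z w - m z * Q z w| <= Num.min (Num.min d12 d13) d23.
    rewrite -dK -mulrBl normrM distrC ler_pM // ger0_norm //.
    exact: rate_boundP.
  have mp z w : 0 <= m z * Q z w by exact: mulr_ge0.
  have H12 := h12 _ _ (mp pt1 pt2) (mp pt2 pt1)
    (le_trans (mQ _ _) _) (le_trans (mQ _ _) _).
  have H13 := h13 _ _ (mp pt1 pt3) (mp pt3 pt1)
    (le_trans (mQ _ _) _) (le_trans (mQ _ _) _).
  have H23 := h23 _ _ (mp pt2 pt3) (mp pt3 pt2)
    (le_trans (mQ _ _) _) (le_trans (mQ _ _) _).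
  have {}H12 := H12 ltac:(by rewrite !ge_min lexx) ltac:(by rewrite !ge_min lexx).
  have {}H13 := H13 ltac:(by rewrite !ge_min lexx ?orbT)
    ltac:(by rewrite !ge_min lexx ?orbT).
  have {}H23 := H23 ltac:(by rewrite !ge_min lexx ?orbT)
    ltac:(by rewrite !ge_min lexx ?orbT).
  have := mobility_edge x00 x01; rewrite mobility3 // -/th.
  have : e * (1 + th ^+ 2 + (1 - th) ^+ 2) = M - conductance x0.
    by rewrite divfK // gt_eqF.
  have := ler_wpM2l (sqr_ge0 th) H13; have := ler_wpM2l (sqr_ge0 (1 - th)) H23.
  by move: H12; lra.
have B0 := speed_bound_gt0 Qge0; set B := speed_bound Q in B0.
have sB0 : 0 < Num.sqrt B by rewrite sqrtr_gt0.
have sM0 : 0 < Num.sqrt M by rewrite sqrtr_gt0.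
exists (d * Num.sqrt M / Num.sqrt B); first by rewrite divr_gt0 // mulr_gt0.
move=> x xr; apply: transport_dist_ge => // mu V A ce A0 IA.
(* A curve with larger action is longer than the distance asked for. *)
have [Ad|Ad] := leP (B * A) (d ^+ 2); last first.
  rewrite ler_pdivrMr //; apply: (le_trans (ltW xr)).
  rewrite mulrAC ler_wpM2r ?sqrtr_ge0 // ler_pdivrMr // mulrC -sqrtrM ?(ltW B0) //.
  by rewrite -(ger0_norm (ltW d0)) -sqrtr_sqr ler_wsqrtr // ltW.
have mun t : 0 <= t <= 1 ->
    mobility L Q (mu t) (lifted_edge_potential th) <= M.
  move=> t01; apply: near_mob => [|z]; first exact: (ce_prob ce).
  have := le_trans (coordinate_increment hL Qge0 ce IA z t01 A0) Ad.
  by rewrite -ler_sqrt ?sqr_ge0 // !sqrtr_sqr (ger0_norm (ltW d0)).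
have := pairing_increment_sqr hL Qge0 ce IA M0 mun (lexx 0) ler01 (lexx 1) A0.
rewrite (ce_start ce) (ce_end ce) /pairing !sum3 /lifted_edge_potential /edge /=.
rewrite !mul0r !mulr0 !add0r !mul1r !addr0 => h.
by rewrite ler_pdivrMr // -sqrtrM // -sqrtr_sqr ler_wsqrtr // mulrC.
Qed.

(** * The action of a flow on the triangle *)

Lemma action_density0 s t : 0 <= s -> 0 <= t -> action_density L s t 0 = 0%E.
Proof.
move=> s0 t0; rewrite /action_density eqxx s0 t0 /=.
by case: ifP => // _; rewrite expr0n mul0r.
Qed.

Lemma action_density_sym s t w : 0 <= s -> 0 <= t ->
  action_density L s t (- w) = action_density L t s w.
Proof.
move=> s0 t0; rewrite /action_density sqrrN oppr_eq0 (am_sym hL s0 t0).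
by rewrite s0 t0 [(0 < s) && _]andbC.
Qed.

Lemma action_flow3 (m : 'I_3 -> R) p q r : (forall z, 0 <= m z) ->
  action L Q m (flow3 p q r) =
  (action_density L (m pt1 * Q pt1 pt2) (m pt2 * Q pt2 pt1) p +
   action_density L (m pt1 * Q pt1 pt3) (m pt3 * Q pt3 pt1) q +
   action_density L (m pt3 * Q pt3 pt2) (m pt2 * Q pt2 pt3) r)%E.
Proof.
move=> m0; have mQ a b : 0 <= m a * Q a b by exact: mulr_ge0.
rewrite /action !esum3 /flow3 /= !action_density0 // !add0e !adde0.
rewrite !action_density_sym //.
set d12 := action_density _ _ _ _; set d13 := action_density _ _ _ _.
set d23 := action_density _ _ _ _.
have h12 : (0 <= d12)%E by exact: action_density_ge0.
have h13 : (0 <= d13)%E by exact: action_density_ge0.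
have h23 : (0 <= d23)%E by exact: action_density_ge0.
move: d12 d13 d23 h12 h13 h23 => [a| |] [b| |] [c| |] //= _ _ _;
  rewrite ?addye ?addey ?gt0_muley ?lte_fin ?invr_gt0 //.
by rewrite -!EFinD -EFinM; congr (_%:E); field.
Qed.

Lemma action_density_le s t w (M : R) : 0 < s -> 0 < t -> w ^+ 2 / L s t <= M ->
  (action_density L s t w <= M%:E)%E.
Proof. by move=> s0 t0 H; rewrite /action_density s0 t0 /= lee_fin. Qed.

Lemma flow3_div (p q r : R) x :
  2^-1 * \sum_y (flow3 p q r x y - flow3 p q r y x) =
  if x == pt1 then p + q else if x == pt2 then - p - r else r - q.
Proof. by have [->|->|->] := pt_cases x; rewrite sum3 /flow3 /=; field. Qed.

(** * Bounds on the conductance *)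

Lemma mean01_ge0 : 0 <= L 0 1.
Proof. exact: (am_ge0 hL). Qed.

Lemma detour_den_gt0 x : 0 < x < 1 -> 0 < (1 - x) * Q pt1 pt3 + x * Q pt2 pt3.
Proof. by move=> /andP[x0 x1]; rewrite addr_gt0 // mulr_gt0 // subr_gt0. Qed.

Lemma detour_gt0 x : 0 < x < 1 -> 0 < detour x.
Proof.
move=> x01; rewrite divr_gt0 ?detour_den_gt0 //.
by case/andP: x01 => x0 x1; rewrite !mulr_gt0 // subr_gt0.
Qed.

Lemma detour_le x : 0 < x < 1 ->
  detour x <= x * (1 - x) * (Q pt1 pt3 + Q pt2 pt3).
Proof.
move=> x01; rewrite ler_pdivrMr ?detour_den_gt0 // -!mulrA.
case/andP: x01 => x0 x1; have y0 : 0 < 1 - x by rewrite subr_gt0.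
rewrite !ler_wpM2l ?(ltW x0) ?(ltW y0) //.
have := mulr_ge0 (mulr_ge0 (ltW y0) (ltW q13)) (ltW q13).
have := mulr_ge0 (mulr_ge0 (ltW x0) (ltW q23)) (ltW q23).
by nra.
Qed.

Lemma direct_gt0 x : 0 < x < 1 -> 0 < L ((1 - x) * Q pt1 pt2) (x * Q pt2 pt1).
Proof.
by move=> /andP[x0 x1]; rewrite (mean_gt0 hL) // mulr_gt0 // subr_gt0.
Qed.

Lemma conductance_gt0 x : 0 < x < 1 -> 0 < conductance x.
Proof.
move=> x01; rewrite ltr_pwDl ?direct_gt0 // mulr_ge0 ?mean01_ge0 //.
exact: ltW (detour_gt0 x01).
Qed.

Definition conductance_max : R := Q pt1 pt2 + Q pt2 pt1 + Q pt1 pt3 + Q pt2 pt3.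

Lemma conductance_max_gt0 : 0 < conductance_max.
Proof. by rewrite !addr_gt0. Qed.

Lemma conductance_le x : 0 < x < 1 -> conductance x <= conductance_max.
Proof.
move=> x01; have /andP[x0 x1] := x01; have y0 : 0 < 1 - x by rewrite subr_gt0.
have h1 : L ((1 - x) * Q pt1 pt2) (x * Q pt2 pt1) <= Q pt1 pt2 + Q pt2 pt1.
  have a1 : (1 - x) * Q pt1 pt2 <= Q pt1 pt2 by rewrite ler_piMl //; lra.
  have a2 : x * Q pt2 pt1 <= Q pt2 pt1 by rewrite ler_piMl //; lra.
  apply: (mean_le_max hL); rewrite ?addr_gt0 ?mulr_ge0 ?(ltW x0) ?(ltW y0) //.
    by apply: le_trans a1 _; rewrite lerDl.
  by apply: le_trans a2 _; rewrite lerDr.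
have lam1 : L 0 1 <= 1.
  by rewrite -[leRHS](am_normalized hL); apply: (am_nondecreasing_l hL).
have g0 := ltW (detour_gt0 x01); have g1 := detour_le x01.
have h2 : L 0 1 * detour x <= Q pt1 pt3 + Q pt2 pt3.
  apply: (@le_trans _ _ (1 * detour x)); first by rewrite ler_wpM2r.
  rewrite mul1r; apply: le_trans g1 _.
  rewrite ler_piMl ?addr_ge0 // mulr_ile1 ?(ltW x0) ?(ltW y0) ?(ltW x1) //; lra.
rewrite /conductance /conductance_max; lra.
Qed.

Notation Cmax := conductance_max.

Definition conductance_min : R := L 0 1 * Num.min (Q pt1 pt2) (Q pt2 pt1) / 2.

Notation Cmin := conductance_min.

Lemma conductance_ge x : 0 < x < 1 -> conductance_min <= conductance x.
Proof.
move=> x01; have /andP[x0 x1] := x01; have y0 : 0 < 1 - x by rewrite subr_gt0.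
have g0 := mulr_ge0 mean01_ge0 (ltW (detour_gt0 x01)).
rewrite /conductance; apply: ler_wpDr => //; rewrite /conductance_min.
have m1 : Num.min (Q pt1 pt2) (Q pt2 pt1) <= Q pt1 pt2 by rewrite ge_min lexx.
have m2 : Num.min (Q pt1 pt2) (Q pt2 pt1) <= Q pt2 pt1 by rewrite ge_min lexx orbT.
have m0 : 0 < Num.min (Q pt1 pt2) (Q pt2 pt1) by rewrite lt_min q12.
have [xh|xh] := leP x (1 / 2).
  apply: (@le_trans _ _ (L ((1 - x) * Q pt1 pt2) 0)).
    rewrite mean0r ?mulr_ge0 ?(ltW y0) // -mulrA [leRHS]mulrC.
    rewrite ler_wpM2l ?mean01_ge0 //.
    have : 0 <= (1 / 2 - x) * Q pt1 pt2 by rewrite mulr_ge0 ?subr_ge0.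
    lra.
  by apply: (am_nondecreasing_r hL); rewrite ?mulr_ge0 ?(ltW y0) ?(ltW x0).
apply: (@le_trans _ _ (L 0 (x * Q pt2 pt1))).
  rewrite (mean0l (t := x * _)) ?mulr_ge0 ?(ltW x0) // -mulrA [leRHS]mulrC.
  rewrite ler_wpM2l ?mean01_ge0 //.
  have : 0 <= (x - 1 / 2) * Q pt2 pt1 by rewrite mulr_ge0 ?subr_ge0 ?(ltW xh).
  lra.
by apply: (am_nondecreasing_l hL); rewrite ?mulr_ge0 ?(ltW y0) ?(ltW x0).
Qed.

Lemma direct_continuous (x : R) : 0 < x < 1 ->
  {for x, continuous (fun y : R => L ((1 - y) * Q pt1 pt2) (y * Q pt2 pt1))}.
Proof.
move=> /andP[x0 x1].
have [+ _] := am_smooth hL 0 => /(_ ((1 - x) * Q pt1 pt2) (x * Q pt2 pt1)).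
rewrite !mulr_gt0 ?subr_gt0 // => /(_ isT isT) cL.
rewrite /prop_for /continuous_at; apply: (@continuous2_cvg R R R R _ _ _ _ L _ _ cL).
  by apply: cvgM; [apply: cvgB; [exact: cvg_cst|exact: cvg_id]|exact: cvg_cst].
by apply: cvgM; [exact: cvg_id|exact: cvg_cst].
Qed.

Lemma detour_continuous (x : R) : 0 < x < 1 -> {for x, continuous detour}.
Proof.
move=> x01; apply: cvgM.
  apply: cvgM; last exact: cvg_cst.
  apply: cvgM; last exact: cvg_cst.
  apply: cvgM; first exact: cvg_id.
  by apply: cvgB; [exact: cvg_cst|exact: cvg_id].
apply: cvgV; first by rewrite gt_eqF // detour_den_gt0.
apply: cvgD; apply: cvgM; try exact: cvg_cst; last exact: cvg_id.
by apply: cvgB; [exact: cvg_cst|exact: cvg_id].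
Qed.

Lemma conductance_continuous (x : R) : 0 < x < 1 ->
  {for x, continuous conductance}.
Proof.
move=> x01; apply: cvgD; first exact: direct_continuous.
by apply: cvgM; [exact: cvg_cst|exact: detour_continuous].
Qed.

Lemma edge0 : edge 0 = dirac_prob R pt1.
Proof.
by apply/funext => z; have [->|->|->] := pt_cases z; rewrite /edge /dirac_prob //= subr0.
Qed.

Lemma edge1 : edge 1 = dirac_prob R pt2.
Proof.
by apply/funext => z; have [->|->|->] := pt_cases z; rewrite /edge /dirac_prob //= subrr.
Qed.

(** The parametrization has vanishing speed at the two vertices, where the
    mean may vanish. *)
Lemma vertex_dist_fin : exists A : R,
  (transport_dist L Q (dirac_prob R pt1) (dirac_prob R pt2) <= A%:E)%E.
Proof.
pose X (t : R) := t ^+ 2 * (3 - 2 * t).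
pose dX (t : R) := 6 * t * (1 - t).
have DX (t : R) : is_derive t 1 X (dX t).
  rewrite /X; apply: is_derive_eq.
  rewrite /GRing.scale /= /dX; ring.
have cdX : continuous dX.
  move=> t; apply: cvgM; first by apply: cvgM; [exact: cvg_cst|exact: cvg_id].
  by apply: cvgB; [exact: cvg_cst|exact: cvg_id].
have X01 t : 0 <= t <= 1 -> 0 <= X t <= 1.
  move=> /andP[t0 t1]; apply/andP; split; first by rewrite mulr_ge0 ?sqr_ge0 //; lra.
  rewrite -subr_ge0 (_ : _ - _ = (1 - t) ^+ 2 * (1 + 2 * t)); last by rewrite /X; ring.
  by rewrite mulr_ge0 ?sqr_ge0 //; lra.
pose nu t := edge (X t).
pose V t := flow3 (dX t) 0 0.
have ce : CE1 (nu 0) (nu 1) nu V.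
  apply: (@CE1_of_derivative _ _ nu (fun t z => if z == pt1 then - dX t else
      if z == pt2 then dX t else 0)).
  - by move=> t t01; apply: is_prob_edge; exact: X01.
  - move=> z t t01; have [->|->|->] := pt_cases z; rewrite /nu /edge /=.
    + by rewrite -[- dX t]sub0r; exact: (is_deriveB (is_derive_cst (1 : R) t 1) (DX t)).
    + exact: DX.
    + exact: is_derive_cst.
  - move=> x y; apply: continuous_subspaceT => t.
    have cst0 : {for t, continuous (fun=> 0 : R)} by exact: cvg_cst.
    have cN : {for t, continuous (fun t => - dX t)} by apply: cvgN; exact: cdX.
    have [->|->|->] := pt_cases x; have [->|->|->] := pt_cases y;
      rewrite /V /flow3 /= ?oppr0 //; exact: cdX.
  - move=> x t t01; rewrite flow3_div !addr0 subr0 subr0.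
    by do 2 (case: ifP => _; rewrite ?opprK ?oppr0 //).
pose k := Num.min (Q pt1 pt2) (Q pt2 pt1).
have k0 : 0 < k by rewrite lt_min q12.
have k1 : k <= Q pt1 pt2 by rewrite ge_min lexx.
have k2 : k <= Q pt2 pt1 by rewrite ge_min lexx orbT.
have bound t : 0 < t < 1 -> (action L Q (nu t) (V t) <= (cst (36 / k) t)%:E)%E.
  move=> /andP[t0 t1]; have t01 : 0 <= t <= 1 by rewrite !ltW.
  have [nu0 _] := is_prob_edge (X01 t t01).
  have nuQ a b : 0 <= nu t a * Q a b by exact: (mulr_ge0 (nu0 a) (Qge0 a b)).
  rewrite action_flow3 // !action_density0 // !adde0.
  have s0 : 0 < 1 - t by rewrite subr_gt0.
  have X0 : 0 < X t by rewrite /X mulr_gt0 ?exprn_gt0 //; lra.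
  have X1 : X t < 1.
    rewrite -subr_gt0 (_ : _ - _ = (1 - t) ^+ 2 * (1 + 2 * t)); last by rewrite /X; ring.
    by rewrite mulr_gt0 ?exprn_gt0 //; lra.
  have XX : t ^+ 2 * (1 - t) ^+ 2 <= X t * (1 - X t).
    rewrite (_ : X t * _ = t ^+ 2 * (1 - t) ^+ 2 * ((3 - 2 * t) * (1 + 2 * t))).
      by rewrite ler_peMr ?mulr_ge0 ?sqr_ge0 //; nra.
    by rewrite /X; ring.
  rewrite /nu /edge /=; have Y0 : 0 < 1 - X t by rewrite subr_gt0.
  apply: action_density_le; [exact: mulr_gt0|exact: mulr_gt0|].
  have h : k * (t ^+ 2 * (1 - t) ^+ 2) <= L ((1 - X t) * Q pt1 pt2) (X t * Q pt2 pt1).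
    apply: le_trans (ler_wpM2l (ltW k0) XX) _; apply: (mean_ge_min hL).
    - by rewrite mulr_gt0 // mulr_gt0.
    - rewrite (_ : k * _ = (1 - X t) * (X t * k)); last by ring.
      by rewrite ler_wpM2l ?(ltW Y0) // (le_trans _ k1) // ler_piMl ?(ltW k0) ?(ltW X1).
    - rewrite (_ : k * _ = X t * ((1 - X t) * k)); last by ring.
      rewrite ler_wpM2l ?(ltW X0) // (le_trans _ k2) // ler_piMl ?(ltW k0) //.
      by rewrite gerBl ltW.
  have tt : 0 < t ^+ 2 * (1 - t) ^+ 2 by rewrite mulr_gt0 // exprn_gt0.
  rewrite ler_pdivrMr; last by apply: lt_le_trans h; rewrite mulr_gt0.
  apply: le_trans (ler_wpM2l _ h); last by rewrite divr_ge0 // ltW.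
  by rewrite le_eqVlt; apply/orP; left; apply/eqP; rewrite /dX; field; rewrite gt_eqF.
have c36 : {within `[0, 1], continuous (cst (36 / k) : R -> R)}.
  by apply: continuous_subspaceT; exact: cst_continuous.
have act0 t : (0 <= action L Q (nu t) (V t))%E by exact: action_ge0.
have := transport_dist_le hL ce (integral_le_interior c36 act0 bound).
have X0 : X 0 = 0 by rewrite /X; ring.
have X1 : X 1 = 1 by rewrite /X; ring.
rewrite /nu X0 X1 edge0 edge1 => H; eexists; exact: H.
Qed.

(** * Lifting mass to the third vertex *)

(** The remaining mass keeps its proportions, so that homogeneity of [L] applies to
    the edge between the first two vertices. *)
Definition lift_edge (x w : R) (z : 'I_3) : R :=
  if z == pt1 then (1 - w) * (1 - x) else if z == pt2 then (1 - w) * x else w.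

Lemma is_prob_lift_edge x w : 0 <= x <= 1 -> 0 <= w <= 1 -> is_prob (lift_edge x w).
Proof.
move=> /andP[x0 x1] /andP[w0 w1]; split=> [z|]; last by rewrite sum3 /lift_edge /=; ring.
by rewrite /lift_edge; case: ifP; [|case: ifP]; rewrite // mulr_ge0 ?subr_ge0.
Qed.

(** The coefficient of the first order interaction between the detour flow and
    the exchange with the third vertex. *)
Definition cross (x : R) : R :=
  if L 0 1 == 0 then 0 else 2 * g x / C x * ((Q pt1 pt3)^-1 + (Q pt2 pt3)^-1).

Definition detour_share (x : R) : R := L 0 1 * g x / C x.

(** The flow of speed [v] along the edge, divided harmonically between the direct
    edge and the detour and scaled by [1 - w], together with the exchange that
    brings mass to the third vertex at rate [z] from the other two in proportion
    to their masses. *)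
Definition lift_flow (x w v z : R) : 'I_3 -> 'I_3 -> R :=
  flow3 ((1 - w) * (1 - detour_share x) * v)
    ((1 - w) * detour_share x * v + (1 - x) * z)
    ((1 - w) * detour_share x * v - x * z).

Lemma detourV x : 0 < x < 1 ->
  (g x)^-1 = ((1 - x) * Q pt1 pt3)^-1 + (x * Q pt2 pt3)^-1.
Proof.
move=> /andP[x0 x1]; have y0 : 0 < 1 - x by rewrite subr_gt0.
have D0 : 0 < (1 - x) * Q pt1 pt3 + x * Q pt2 pt3 by rewrite addr_gt0 // mulr_gt0.
by rewrite /detour; field; rewrite !gt_eqF.
Qed.

(** By homogeneity the scaled flow on the scaled masses has [1 - w] times the
    action of the harmonic flow, which is [v ^ 2 / C x]; the rest is the price of
    the exchange, expanded with [sqr_sum_div_le] on the two edges at the third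
    vertex. *)
Lemma action_lift x w v z : 0 < x < 1 -> 0 < w < 1 -> 0 <= v ->
  (action L Q (lift_edge x w) (lift_flow x w v z) <=
   ((1 - w) * (v ^+ 2 / C x) + cross x * v * `|z| +
    (z ^+ 2 / L ((1 - w) * (1 - x) * Q pt1 pt3) (w * Q pt3 pt1) +
     z ^+ 2 / L (w * Q pt3 pt2) ((1 - w) * x * Q pt2 pt3)))%:E)%E.
Proof.
move=> x01 w01 v0; have /andP[x0 x1] := x01; have /andP[w0 w1] := w01.
have y0 : 0 < 1 - x by rewrite subr_gt0.
have u0 : 0 < 1 - w by rewrite subr_gt0.
have g0 := detour_gt0 x01; have C0 := conductance_gt0 x01.
have D0 := direct_gt0 x01.
have lam0 := mean01_ge0.
have [m0 _] : is_prob (lift_edge x w) by apply: is_prob_lift_edge; rewrite !ltW.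
rewrite action_flow3 // /lift_edge /=.
set lam := L 0 1 in lam0 *.
pose h := (1 - w) * g x * v / C x.
have h0 : 0 <= h by apply: divr_ge0 (ltW C0); rewrite mulr_ge0 // ltW // mulr_gt0.
pose n13 := (1 - w) * (1 - x) * Q pt1 pt3; pose n23 := (1 - w) * x * Q pt2 pt3.
have n13_gt0 : 0 < n13 by rewrite !mulr_gt0.
have n23_gt0 : 0 < n23 by rewrite !mulr_gt0.
have L13 : 0 < L n13 (w * Q pt3 pt1) by apply: (mean_gt0 hL) => //; rewrite mulr_gt0.
have L23 : 0 < L (w * Q pt3 pt2) n23 by apply: (mean_gt0 hL) => //; rewrite mulr_gt0.
have b13 : n13 * lam <= L n13 (w * Q pt3 pt1).
  rewrite -mean0r ?(ltW n13_gt0) //; apply: (am_nondecreasing_r hL) => //.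
    exact: ltW.
  by rewrite mulr_ge0 // ltW.
have b23 : n23 * lam <= L (w * Q pt3 pt2) n23.
  rewrite -mean0l ?(ltW n23_gt0) //; apply: (am_nondecreasing_l hL) => //.
    by rewrite mulr_ge0 // ltW.
  exact: ltW.
have y01 : 0 <= 1 - x <= 1 by lra.
have x01' : 0 <= x <= 1 by lra.
have := sqr_sum_div_le z n13_gt0 L13 lam0 b13 h0 y01.
have := sqr_sum_div_le (- z) n23_gt0 L23 lam0 b23 h0 x01'.
rewrite normrN sqrrN => B23 B13.
have Dw : L ((1 - w) * (1 - x) * Q pt1 pt2) ((1 - w) * x * Q pt2 pt1) =
    (1 - w) * L ((1 - x) * Q pt1 pt2) (x * Q pt2 pt1).
  by rewrite -!mulrA (am_homogeneous hL) // mulr_ge0 // ltW.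
apply: le_trans.
  apply: leeD; first apply: leeD.
  - apply: action_density_le (lexx _); by rewrite !mulr_gt0.
  - apply: action_density_le; [exact: n13_gt0|by rewrite mulr_gt0|].
    apply: le_trans B13; rewrite le_eqVlt; apply/orP; left; apply/eqP.
    congr (_ ^+ 2 / _); rewrite /h /detour_share -/lam; ring.
  - apply: action_density_le; [by rewrite mulr_gt0|exact: n23_gt0|].
    apply: le_trans B23; rewrite le_eqVlt; apply/orP; left; apply/eqP.
    congr (_ ^+ 2 / _); rewrite /h /detour_share -/lam; ring.
rewrite -!EFinD lee_fin Dw.
set D := L ((1 - x) * Q pt1 pt2) (x * Q pt2 pt1) in D0 *.
have CE : C x = D + lam * g x by [].
have main : ((1 - w) * (1 - detour_share x) * v) ^+ 2 / ((1 - w) * D) +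
   (h ^+ 2 * lam / n13 + h ^+ 2 * lam / n23) = (1 - w) * (v ^+ 2 / C x).
  have -> : h ^+ 2 * lam / n13 + h ^+ 2 * lam / n23 = h ^+ 2 * lam / (1 - w) * (g x)^-1.
    by rewrite detourV // /n13 /n23; field; rewrite !gt_eqF.
  have -> : 1 - detour_share x = D / C x.
    by rewrite /detour_share -/lam -[X in X - _](divff (lt0r_neq0 C0)) -mulrBl CE addrK.
  have -> : (1 - w) * (v ^+ 2 / C x) = (1 - w) * (v ^+ 2 * (D + lam * g x) / C x ^+ 2).
    by rewrite -CE; field; rewrite gt_eqF.
  by rewrite /h; field; rewrite !gt_eqF.
have crossE : cross x * v * `|z| =
    (if lam == 0 then 0 else 2 * h * (1 - x) * `|z| / n13) +
    (if lam == 0 then 0 else 2 * h * x * `|z| / n23).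
  rewrite /cross -/lam; case: ifP => _; first by rewrite !mul0r addr0.
  by rewrite /h /n13 /n23; field; rewrite !gt_eqF.
rewrite -main crossE -/n13 -/n23 le_eqVlt; apply/orP; left; apply/eqP.
by case: (lam == 0); ring.
Qed.

(** * Arcs of the edge *)

(** Constant speed [l] for the length element [dx / sqrt (C x)]. *)
Record edge_arc (a l : R) (X : R -> R) : Prop := EdgeArc {
  arc_a_gt0 : 0 < a;
  arc_a_lt : a < 1 / 2;
  arc_l_gt0 : 0 < l;
  arc_start : X 0 = a;
  arc_end : X 1 = 1 - a;
  arc_range : forall t, 0 <= t <= 1 -> a <= X t <= 1 - a;
  arc_derive : forall t : R, 0 <= t <= 1 -> is_derive t 1 X (l * Num.sqrt (C (X t)))
}.

Section one_arc.
Context {a l : R} {X : R -> R} (arc : edge_arc a l X).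

Lemma arc_in t : 0 <= t <= 1 -> 0 < X t < 1.
Proof.
by move=> t01; have := arc_range arc t01; have := arc_a_gt0 arc; lra.
Qed.

Lemma arc_MVT s t : 0 <= s -> s <= t -> t <= 1 ->
  exists2 z, 0 <= z <= 1 & X t - X s = l * Num.sqrt (C (X z)) * (t - s).
Proof.
move=> s0 st t1.
have [z||] := @MVT_segment R X (fun z => l * Num.sqrt (C (X z))) s t st.
- by rewrite in_itv /= => /andP[sz zt]; apply: (arc_derive arc); lra.
- apply: derivable_within_continuous => z; rewrite in_itv /= => /andP[sz zt].
  by have [] : is_derive z 1 X (l * Num.sqrt (C (X z))) by apply: (arc_derive arc); lra.
- by move=> z; rewrite in_itv /= => /andP[sz zt] e; exists z => //; lra.
Qed.

Lemma arc_speed_le t : 0 <= t <= 1 -> l * Num.sqrt (C (X t)) <= l * Num.sqrt Cmax.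
Proof.
move=> t01; rewrite ler_wpM2l ?(ltW (arc_l_gt0 arc)) // ler_wsqrtr //.
by apply: conductance_le; exact: arc_in.
Qed.

Lemma arc_length_lower : a <= 1 / 4 -> (4 * Cmax)^-1 <= l ^+ 2.
Proof.
move=> a4; have [z z01] := arc_MVT (lexx 0) ler01 (lexx 1).
rewrite (arc_start arc) (arc_end arc) subr0 mulr1 => lz.
have := arc_speed_le z01; rewrite -lz => h.
have M0 : 0 < Cmax by exact: conductance_max_gt0.
have h2 : 1 / 2 <= l * Num.sqrt Cmax by lra.
have : (1 / 2) ^+ 2 <= (l * Num.sqrt Cmax) ^+ 2.
  by rewrite ler_pXn2r // nnegrE; lra.
rewrite [(l * _) ^+ 2]exprMn sqr_sqrtr ?(ltW M0) // => h3.
by rewrite invf_ple ?posrE ?mulr_gt0 ?exprn_gt0 ?(arc_l_gt0 arc) //;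
  rewrite -[_^-1]mul1r ler_pdivrMr ?exprn_gt0 ?(arc_l_gt0 arc) //; lra.
Qed.

End one_arc.

(** The interaction carries the factor [x * (1 - x)] of the detour. If [L 0 1 > 0]
    the conductance is bounded away from zero, so the speed of an arc is bounded
    independently of [a], and [X t * (1 - X t)] is at most a multiple of
    [a + t * (1 - t)]. *)
Lemma cross_uniform : exists2 K : R, 0 <= K & forall a l X, edge_arc a l X ->
  forall t, 0 <= t <= 1 ->
  cross (X t) * (l * Num.sqrt (C (X t))) <= K * (a + t * (1 - t)).
Proof.
have [lam0|lam0] := eqVneq (L 0 1) 0.
  by exists 0 => // a l X arc t t01; rewrite /cross lam0 eqxx !mul0r.
have lam_gt0 : 0 < L 0 1 by rewrite lt_neqAle eq_sym lam0 mean01_ge0.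
have M0 : 0 < Cmax by exact: conductance_max_gt0.
have m0 : 0 < Cmin by rewrite divr_gt0 // mulr_gt0 // lt_min q12.
pose k := Num.sqrt Cmax / Num.sqrt Cmin.
have sm0 : 0 < Num.sqrt Cmin by rewrite sqrtr_gt0.
have k0 : 0 <= k by rewrite divr_ge0 ?sqrtr_ge0.
pose b := 2 * (Q pt1 pt3 + Q pt2 pt3) * ((Q pt1 pt3)^-1 + (Q pt2 pt3)^-1) / Cmin.
have b0 : 0 <= b.
  by rewrite divr_ge0 ?(ltW m0) // !mulr_ge0 // addr_ge0 ?invr_ge0.
exists (b * (1 + 2 * k)); first by rewrite mulr_ge0 // addr_ge0 // mulr_ge0.
move=> a l X arc t t01.
have l0 := arc_l_gt0 arc; have Xt := arc_in arc t01.
have sC z : 0 <= z <= 1 -> Num.sqrt Cmin <= Num.sqrt (C (X z)).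
  by move=> z01; rewrite ler_wsqrtr // conductance_ge // (arc_in arc).
have lsm : l * Num.sqrt Cmin <= 1.
  have [z z01] := arc_MVT arc (lexx 0) ler01 (lexx 1).
  rewrite (arc_start arc) (arc_end arc) subr0 mulr1 => lz.
  apply: le_trans (ler_wpM2l (ltW l0) (sC z z01)) _; rewrite -lz.
  by have := arc_a_gt0 arc; lra.
have lk : l * Num.sqrt Cmax <= k.
  by rewrite /k ler_pdivlMr // mulrAC ler_piMl ?sqrtr_ge0.
have XX : X t * (1 - X t) <= (1 + 2 * k) * (a + t * (1 - t)).
  have [t0 t1] := andP t01; have [X0 X1] := andP Xt.
  have a0 := arc_a_gt0 arc.
  have tt : 0 <= t * (1 - t) by rewrite mulr_ge0 // subr_ge0.
  have lo : X t <= a + k * t.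
    have [z z01] := arc_MVT arc (lexx 0) t0 t1.
    rewrite (arc_start arc) subr0 => /eqP; rewrite subr_eq => /eqP ->.
    rewrite addrC lerD2l ler_wpM2r //.
    exact: le_trans (arc_speed_le arc z01) lk.
  have hi : 1 - X t <= a + k * (1 - t).
    have [z z01 e] := arc_MVT arc t0 t1 (lexx 1).
    have : X 1 - X t <= k * (1 - t).
      rewrite e ler_wpM2r ?subr_ge0 //.
      exact: le_trans (arc_speed_le arc z01) lk.
    by rewrite (arc_end arc); lra.
  have kt0 : 0 <= k * t by rewrite mulr_ge0.
  have kt1 : 0 <= k * (1 - t) by rewrite mulr_ge0 // subr_ge0.
  have [th|th] := leP t (1 / 2).
    have h1 : X t * (1 - X t) <= a + k * t.
      by apply: le_trans lo; rewrite ler_piMr ?(ltW X0) // gerBl ltW.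
    have h2 : k * t <= 2 * k * (t * (1 - t)).
      have : 0 <= k * t * (1 - 2 * t) by apply: mulr_ge0 => //; lra.
      lra.
    by have := mulr_ge0 k0 (ltW a0); lra.
  have h1 : X t * (1 - X t) <= a + k * (1 - t).
    by apply: le_trans hi; rewrite ler_piMl ?subr_ge0 ?(ltW X1).
  have h2 : k * (1 - t) <= 2 * k * (t * (1 - t)).
    have : 0 <= k * (1 - t) * (2 * t - 1) by apply: mulr_ge0 => //; lra.
    lra.
  by have := mulr_ge0 k0 (ltW a0); lra.
have c0 := conductance_gt0 Xt.
have sc0 : 0 < Num.sqrt (C (X t)) by rewrite sqrtr_gt0.
rewrite /cross (negPf lam0) -[leRHS]mulrA; apply: le_trans (ler_wpM2l b0 XX).
have -> : 2 * g (X t) / C (X t) * ((Q pt1 pt3)^-1 + (Q pt2 pt3)^-1) *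
    (l * Num.sqrt (C (X t))) =
    2 * ((Q pt1 pt3)^-1 + (Q pt2 pt3)^-1) * (g (X t) * (l / Num.sqrt (C (X t)))).
  rewrite -{1}[C (X t)](sqr_sqrtr (ltW c0)).
  by move: sc0; move: (Num.sqrt _) (g (X t)) => s w s0; field; rewrite !gt_eqF.
have -> : b * (X t * (1 - X t)) = 2 * ((Q pt1 pt3)^-1 + (Q pt2 pt3)^-1) *
    (X t * (1 - X t) * (Q pt1 pt3 + Q pt2 pt3) * Cmin^-1).
  by rewrite /b; ring.
rewrite ler_wpM2l //; first by rewrite mulr_ge0 // addr_ge0 ?invr_ge0.
apply: ler_pM; [exact: ltW (detour_gt0 Xt)|by rewrite divr_ge0 ?(ltW l0) ?(ltW sc0)|
  exact: (detour_le Xt)|].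
rewrite ler_pdivrMr // -ler_pdivrMl //; last by rewrite invr_gt0.
rewrite invrK; apply: le_trans (sC t t01).
by rewrite -[X in X * l](sqr_sqrtr (ltW m0)) expr2 -mulrA ler_piMr ?sqrtr_ge0 // mulrC.
Qed.

(** Equality holds in [L c (c * w) = c * w * L 1 w^-1]: a vertex with little mass
    [w] is reached through a mobility that is large compared with [w] as soon as
    [L 1] is unbounded. *)
Lemma mean_small c e s t w : 0 < c -> 0 < w -> w <= e -> c <= s -> c * w <= t ->
  c * w * L 1 e^-1 <= L s t.
Proof.
move=> c0 w0 we cs cwt; have e0 := lt_le_trans w0 we.
have cw0 : 0 < c * w by rewrite mulr_gt0.
apply: (@le_trans _ _ (L c (c * w))).
  have -> : L c (c * w) = c * w * L 1 w^-1.
    rewrite -(am_homogeneous hL) ?invr_ge0 ?(ltW w0) // mulr1 mulfK ?gt_eqF //.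
    by rewrite (am_sym hL) // ltW.
  rewrite ler_wpM2l ?(ltW cw0) //; apply: (am_nondecreasing_r hL) => //.
    by rewrite invr_ge0 ltW.
  by rewrite lef_pV2.
apply: (@le_trans _ _ (L s (c * w))).
  by apply: (am_nondecreasing_l hL); rewrite ?(ltW c0) ?(ltW cw0).
by apply: (am_nondecreasing_r hL); rewrite ?(ltW cw0) // (le_trans (ltW c0)).
Qed.

(** * The shortcut *)

(** Vanishes at both ends of the unit interval, and approaches 1 inside as [k]
    grows. The mass moved is proportional to its square, so that the squared rate
    of change is controlled by the mass itself. *)
Definition plateau k (t : R) : R := 1 - ((2 * t - 1) ^+ 2) ^+ k.+1.

Definition dplateau k (t : R) : R :=
  - (k.+1%:R * ((2 * t - 1) ^+ 2) ^+ k * (4 * (2 * t - 1))).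

Lemma is_derive_plateau k (t : R) : is_derive t 1 (plateau k) (dplateau k t).
Proof.
have dA : is_derive t 1 (fun t : R => 2 * t - 1) 2 by exact: is_derive_affine.
have H := is_derive_exprn k.+1 (is_derive_exprn 2 dA).
have H2 := is_deriveB (is_derive_cst (1 : R) t 1) H.
apply: (@is_derive_eq _ _ _ (plateau k) _ _ _ _ H2).
by rewrite /dplateau /= expr1; ring.
Qed.

Lemma dplateau_continuous k : continuous (dplateau k).
Proof.
move=> t.
have dA (u : R) : is_derive u 1 (fun t : R => 2 * t - 1) 2 by exact: is_derive_affine.
apply: cvgN; apply: cvgM.
  apply: cvgM; first exact: cvg_cst.
  exact: is_derive_continuous (is_derive_exprn k (is_derive_exprn 2 (dA t))).
by apply: cvgM; [exact: cvg_cst|exact: is_derive_continuous (dA t)].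
Qed.

Lemma plateau_bounds k (t : R) : 0 < t < 1 ->
  [/\ 0 < plateau k t, plateau k t <= 1 &
      `|dplateau k t| <= 4 * k.+1%:R * ((2 * t - 1) ^+ 2) ^+ k].
Proof.
move=> t01; have Y0 : 0 <= (2 * t - 1) ^+ 2 by exact: sqr_ge0.
have Y1 : (2 * t - 1) ^+ 2 < 1.
  by rewrite -subr_gt0 (_ : _ - _ = 4 * (t * (1 - t))); [nra|ring].
split.
- by rewrite subr_gt0 exprn_ilt1.
- by rewrite /plateau gerBl exprn_ge0.
have p0 : 0 <= k.+1%:R * ((2 * t - 1) ^+ 2) ^+ k.
  exact: mulr_ge0 (ler0n _ _) (exprn_ge0 _ Y0).
have h : `|4 * (2 * t - 1)| <= 4 by rewrite ler_norml; lra.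
rewrite /dplateau normrN normrM (ger0_norm p0) -[leRHS]mulrA [leRHS]mulrC.
exact: ler_wpM2l.
Qed.

Lemma lift_edge0 (x : R) : lift_edge x 0 = edge x.
Proof. by apply/funext => z; rewrite /lift_edge /edge subr0 !mul1r. Qed.

Lemma plateau0 k : plateau k 0 = 0.
Proof. by rewrite /plateau mulr0 sub0r sqrrN expr1n expr1n subrr. Qed.

Lemma plateau1 k : plateau k 1 = 0.
Proof. by rewrite /plateau mulr1 (_ : 2 - 1 = 1) ?expr1n ?expr1n ?subrr //; ring. Qed.

Section estimate.
Context {a l : R} {X : R -> R} (arc : edge_arc a l X).
Context {K eps c zeta : R} {k : nat}.
(* [c] bounds the fixed arguments of the mobilities at the third vertex from
   below, and [eps * zeta] bounds the quadratic cost of the exchange. *)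
Hypothesis crossK : forall t, 0 <= t <= 1 ->
  cross (X t) * (l * Num.sqrt (C (X t))) <= K * (a + t * (1 - t)).
Hypotheses (eps0 : 0 < eps) (eps1 : eps <= 1 / 2) (c0 : 0 < c).
Hypotheses (c13 : c <= a * Q pt1 pt3 / 2) (c23 : c <= a * Q pt2 pt3 / 2).
Hypotheses (c31 : c <= Q pt3 pt1) (c32 : c <= Q pt3 pt2).
Hypothesis zetaP : 128 * k.+1%:R ^+ 2 / (c * L 1 eps^-1) <= zeta.

Let w t := eps * plateau k t ^+ 2.
Let dw t := eps * (2 * plateau k t * dplateau k t).
Let v t := l * Num.sqrt (C (X t)).
Let nu t := lift_edge (X t) (w t).
Let V t := lift_flow (X t) (w t) (v t) (dw t).

Let dwP (t : R) : is_derive t 1 w (dw t).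
Proof.
have H := is_deriveZ eps (is_derive_exprn 2 (is_derive_plateau k t)).
apply: (@is_derive_eq _ _ _ w _ _ _ _ H).
by rewrite /GRing.scale /= /dw expr1.
Qed.

Let cX t : 0 <= t <= 1 -> {for t, continuous X}.
Proof. by move=> t01; exact: is_derive_continuous (arc_derive arc t01). Qed.

Let cw : continuous w.
Proof. by move=> t; exact: is_derive_continuous (dwP t). Qed.

Let cdw : continuous dw.
Proof.
move=> t; apply: cvgM; first exact: cvg_cst.
apply: cvgM; last exact: dplateau_continuous.
apply: cvgM; first exact: cvg_cst.
exact: is_derive_continuous (is_derive_plateau k t).
Qed.

Let cCX t : 0 <= t <= 1 -> {for t, continuous (fun t => C (X t))}.
Proof.
move=> t01; apply: (@continuous_comp _ _ _ X C); first exact: cX.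
by apply: conductance_continuous; exact: (arc_in arc).
Qed.

Let cv t : 0 <= t <= 1 -> {for t, continuous v}.
Proof.
move=> t01; apply: cvgM; first exact: cvg_cst.
apply: (@continuous_comp _ _ _ (fun t => C (X t)) Num.sqrt); first exact: cCX.
exact: sqrt_continuous.
Qed.

Let cshare t : 0 <= t <= 1 ->
  {for t, continuous (fun t => detour_share (X t))}.
Proof.
move=> t01; have Xt := arc_in arc t01; apply: cvgM.
  apply: cvgM; first exact: cvg_cst.
  apply: (@continuous_comp _ _ _ X g); first exact: cX.
  exact: detour_continuous.
apply: cvgV; last exact: cCX.
by rewrite gt_eqF // conductance_gt0.
Qed.

Let ce : CE1 (nu 0) (nu 1) nu V.
Proof.
have w01 t : 0 <= t <= 1 -> 0 <= w t <= 1.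
  move=> t01; rewrite /w mulr_ge0 ?sqr_ge0 ?(ltW eps0) //=.
  have Y0 : 0 <= (2 * t - 1) ^+ 2 by exact: sqr_ge0.
  have Y1 : (2 * t - 1) ^+ 2 <= 1.
    by rewrite -subr_ge0 (_ : _ - _ = 4 * (t * (1 - t))); [nra|ring].
  have p0 : 0 <= plateau k t by rewrite subr_ge0 exprn_ile1.
  have p1 : plateau k t <= 1 by rewrite /plateau gerBl exprn_ge0.
  have q1 : plateau k t ^+ 2 <= 1 by rewrite expr_le1.
  apply: le_trans (ler_wpM2l (ltW eps0) q1) _; rewrite mulr1.
  by apply: le_trans eps1 _; lra.
pose dnu t (z : 'I_3) := if z == pt1 then - (dw t * (1 - X t)) - (1 - w t) * v t
  else if z == pt2 then (1 - w t) * v t - dw t * X t else dw t.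
apply: (@CE1_of_derivative _ _ nu dnu).
- move=> t t01; apply: is_prob_lift_edge; last exact: w01.
  by have := arc_in arc t01; lra.
- move=> z t t01; have dX := arc_derive arc t01; have dW := dwP t.
  have dW1 := is_deriveB (is_derive_cst (1 : R) t 1) dW.
  have dX1 := is_deriveB (is_derive_cst (1 : R) t 1) dX.
  have [->|->|->] := pt_cases z; rewrite /nu /lift_edge /dnu /=.
  + apply: (is_derive_eq (is_deriveM dW1 dX1)).
    by rewrite !fctE /GRing.scale /= /v; ring.
  + apply: (is_derive_eq (is_deriveM dW1 dX)).
    by rewrite !fctE /GRing.scale /= /v; ring.
  + exact: dW.
- move=> x y; apply: continuous_in_subspaceT => t; rewrite inE /= in_itv /= => t01.
  have cu : {for t, continuous (fun t => 1 - w t)}.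
    by apply: cvgB; [exact: cvg_cst|exact: cw].
  have cs := cshare t01.
  have cp : {for t, continuous
      (fun t => (1 - w t) * (1 - detour_share (X t)) * v t)}.
    apply: cvgM; last exact: cv.
    by apply: cvgM => //; apply: cvgB; [exact: cvg_cst|exact: cs].
  have cb : {for t, continuous
      (fun t => (1 - w t) * detour_share (X t) * v t)}.
    by apply: cvgM; [apply: cvgM|exact: cv].
  have cq : {for t, continuous
      (fun t => (1 - w t) * detour_share (X t) * v t +
      (1 - X t) * dw t)}.
    apply: cvgD => //; apply: cvgM; last exact: cdw.
    by apply: cvgB; [exact: cvg_cst|exact: cX].
  have cr : {for t, continuous
      (fun t => (1 - w t) * detour_share (X t) * v t -
      X t * dw t)}.
    by apply: cvgB => //; apply: cvgM; [exact: cX|exact: cdw].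
  have cz : {for t, continuous (fun=> 0 : R)} by exact: cvg_cst.
  have [->|->|->] := pt_cases x; have [->|->|->] := pt_cases y;
    rewrite /V /lift_flow /flow3 //=; by apply: cvgN.
- move=> x t t01; rewrite flow3_div.
  by have [->|->|->] := pt_cases x; rewrite /dnu /=; ring.
Qed.

(* [1 - 2 * Y ^ (k + 1)], with [Y = (2 * t - 1) ^ 2], bounds the squared plateau
   from below, and [8 * (k + 1) * Y ^ k] bounds the modulus of its derivative. *)
Let E t := l ^+ 2 + eps * (zeta - l ^+ 2 * (1 - 2 * ((2 * t - 1) ^+ 2) ^+ k.+1) +
  K * (a + t * (1 - t)) * (8 * k.+1%:R * ((2 * t - 1) ^+ 2) ^+ k)).

Let action_le t : 0 < t < 1 -> (action L Q (nu t) (V t) <= (E t)%:E)%E.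
Proof.
move=> t01; have t01' : 0 <= t <= 1 by lra.
have [p0 p1 dp] := plateau_bounds k t01.
have Xt := arc_in arc t01'; have Xr := arc_range arc t01'.
have l0 := arc_l_gt0 arc.
have p2 : plateau k t ^+ 2 <= 1 by rewrite expr_le1 // ltW.
have p20 : 0 < plateau k t ^+ 2 by rewrite exprn_gt0.
have w0 : 0 < w t by rewrite mulr_gt0.
have we : w t <= eps by rewrite ler_piMr // ltW.
have wh : w t <= 1 / 2 by exact: le_trans we eps1.
have w01 : 0 < w t < 1 by rewrite w0; apply: le_lt_trans wh _; lra.
have v0 : 0 <= v t by rewrite mulr_ge0 ?sqrtr_ge0 // ltW.
apply: le_trans (action_lift (dw t) Xt w01 v0) _.
have C0 := conductance_gt0 Xt.
have vC : v t ^+ 2 / C (X t) = l ^+ 2.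
  by rewrite /v exprMn sqr_sqrtr ?(ltW C0) // mulfK // gt_eqF.
have Le0 : 0 < L 1 eps^-1 by rewrite (mean_gt0 hL) // invr_gt0.
have cL0 : 0 < c * w t * L 1 eps^-1 by rewrite !mulr_gt0.
have a0 := arc_a_gt0 arc.
have h13 : c * w t * L 1 eps^-1 <=
    L ((1 - w t) * (1 - X t) * Q pt1 pt3) (w t * Q pt3 pt1).
  apply: (mean_small c0 w0 we); last by rewrite mulrC ler_wpM2l // ltW.
  apply: le_trans c13 _; rewrite mulrAC ler_wpM2r ?(ltW q13) //.
  have : 0 <= (1 / 2 - w t) * (1 - X t) by apply: mulr_ge0; lra.
  lra.
have h23 : c * w t * L 1 eps^-1 <=
    L (w t * Q pt3 pt2) ((1 - w t) * X t * Q pt2 pt3).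
  have s1 : 0 <= w t * Q pt3 pt2 by exact: mulr_ge0 (ltW w0) (Qge0 _ _).
  have s2 : 0 <= (1 - w t) * X t * Q pt2 pt3.
    by apply: mulr_ge0 (Qge0 _ _); apply: mulr_ge0; lra.
  rewrite (am_sym hL s1 s2).
  apply: (mean_small c0 w0 we); last by rewrite mulrC ler_wpM2l // ltW.
  apply: le_trans c23 _; rewrite mulrAC ler_wpM2r ?(ltW q23) //.
  have : 0 <= (1 / 2 - w t) * X t by apply: mulr_ge0; lra.
  lra.
set Y := (2 * t - 1) ^+ 2 in dp *.
have Y0 : 0 <= Y by exact: sqr_ge0.
have Y1 : Y <= 1.
  by rewrite -subr_ge0 (_ : _ - _ = 4 * (t * (1 - t))); [nra|rewrite /Y; ring].
have n0 : 0 <= k.+1%:R :> R by [].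
have dwn : `|dw t| <= eps * (8 * k.+1%:R * Y ^+ k).
  rewrite /dw !normrM (gtr0_norm eps0) (gtr0_norm p0) ger0_norm //.
  rewrite ler_wpM2l ?(ltW eps0) //.
  have : plateau k t * `|dplateau k t| <= 1 * (4 * k.+1%:R * Y ^+ k).
    by rewrite ler_pM ?(ltW p0).
  lra.
have dp4 : dplateau k t ^+ 2 <= 16 * k.+1%:R ^+ 2.
  have h : `|dplateau k t| <= 4 * k.+1%:R.
    by apply: le_trans dp _; rewrite ler_piMr ?mulr_ge0 // exprn_ile1.
  rewrite -[X in X <= _]real_normK ?num_real //.
  rewrite (_ : 16 * _ = (4 * k.+1%:R) ^+ 2); last by ring.
  have n4 : 0 <= 4 * k.+1%:R :> R by exact: mulr_ge0.
  by rewrite ler_pXn2r ?nnegrE.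
have dw2 : dw t ^+ 2 <= eps * (64 * k.+1%:R ^+ 2) * w t.
  have -> : dw t ^+ 2 = eps ^+ 2 * plateau k t ^+ 2 * 4 * dplateau k t ^+ 2.
    by rewrite /dw; ring.
  have -> : eps * (64 * k.+1%:R ^+ 2) * w t =
      eps ^+ 2 * plateau k t ^+ 2 * 4 * (16 * k.+1%:R ^+ 2) by rewrite /w; ring.
  apply: ler_wpM2l => //.
  exact: mulr_ge0 (mulr_ge0 (sqr_ge0 _) (sqr_ge0 _)) (ler0n _ 4).
have third M : c * w t * L 1 eps^-1 <= M -> dw t ^+ 2 / M <= eps * (zeta / 2).
  move=> hM; have M0 := lt_le_trans cL0 hM.
  rewrite ler_pdivrMr //; apply: le_trans dw2 _.
  have z2 : 64 * k.+1%:R ^+ 2 <= zeta / 2 * (c * L 1 eps^-1).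
    by move: zetaP; rewrite ler_pdivrMr ?mulr_gt0 //; lra.
  have z0 : 0 <= zeta / 2.
    rewrite divr_ge0 //; apply: le_trans zetaP.
    by rewrite divr_ge0 ?mulr_ge0 ?sqr_ge0 ?(ltW c0) ?(ltW Le0).
  have -> : eps * (64 * k.+1%:R ^+ 2) * w t = eps * (w t * (64 * k.+1%:R ^+ 2)) by ring.
  have -> : eps * (zeta / 2) * M = eps * (zeta / 2 * M) by ring.
  apply: (ler_wpM2l (ltW eps0)); apply: le_trans (ler_wpM2l z0 hM).
  have -> : zeta / 2 * (c * w t * L 1 eps^-1) = w t * (zeta / 2 * (c * L 1 eps^-1)).
    by ring.
  exact: (ler_wpM2l (ltW w0) z2).
have := third _ h13; have := third _ h23.
have cr : cross (X t) * v t * `|dw t| <=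
    K * (a + t * (1 - t)) * (eps * (8 * k.+1%:R * Y ^+ k)).
  apply: le_trans (ler_wpM2l _ dwn) _.
    rewrite mulr_ge0 // /cross; case: ifP => // _.
    apply: mulr_ge0; last by apply: addr_ge0; rewrite invr_ge0.
    apply: divr_ge0 (ltW C0); apply: mulr_ge0 => //.
    exact: ltW (detour_gt0 Xt).
  apply: ler_wpM2r; last exact: crossK.
  by apply: mulr_ge0 (ltW eps0) _; apply: mulr_ge0; [apply: mulr_ge0|exact: exprn_ge0].
have main : (1 - w t) * l ^+ 2 <= l ^+ 2 + eps * (- (l ^+ 2 * (1 - 2 * Y ^+ k.+1))).
  have -> : w t = eps * (1 - Y ^+ k.+1) ^+ 2 by [].
  have := mulr_ge0 (ltW eps0) (mulr_ge0 (sqr_ge0 l) (sqr_ge0 (Y ^+ k.+1))).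
  by move: (Y ^+ k.+1) (l ^+ 2) => y m; lra.
move=> H1 H2; rewrite lee_fin vC /E -/Y.
by move: H1 H2 cr main; lra.
Qed.

(** The radicand is the integral of [E] over the unit interval. *)
Lemma shortcut_bound : (transport_dist L Q (edge a) (edge (1 - a)) <=
  (Num.sqrt (l ^+ 2 + eps * (zeta - l ^+ 2 +
     8 * k.+1%:R * K * (a + 1 / 4) / (k.*2.+1)%:R +
     (2 * l ^+ 2 - 2 * k.+1%:R * K) / (k.+1.*2.+1)%:R)))%:E)%E.
Proof.
have nu0 : nu 0 = edge a.
  by rewrite /nu /w plateau0 expr0n mulr0 lift_edge0 (arc_start arc).
have nu1 : nu 1 = edge (1 - a).
  by rewrite /nu /w plateau1 expr0n mulr0 lift_edge0 (arc_end arc).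
have cY j : continuous (fun t : R => ((2 * t - 1) ^+ 2) ^+ j).
  move=> t; have dA : is_derive t 1 (fun t : R => 2 * t - 1) 2 by exact: is_derive_affine.
  exact: is_derive_continuous (is_derive_exprn j (is_derive_exprn 2 dA)).
pose b0 := l ^+ 2 + eps * (zeta - l ^+ 2).
pose b1 := eps * (8 * k.+1%:R * K * (a + 1 / 4)).
pose b2 := eps * (2 * l ^+ 2 - 2 * k.+1%:R * K).
have E_def : E = (fun t => b0 + (b1 * ((2 * t - 1) ^+ 2) ^+ k +
    b2 * ((2 * t - 1) ^+ 2) ^+ k.+1)).
  apply/funext => t; rewrite /E /b0 /b1 /b2 [_ ^+ k.+1]exprS.
  have -> : t * (1 - t) = (1 - (2 * t - 1) ^+ 2) / 4 by field.
  by move: ((2 * t - 1) ^+ 2) => Y; move: (Y ^+ k) => y; field.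
have cE : {within `[0, 1], continuous E}.
  rewrite E_def; apply: continuous_subspaceT => t.
  apply: cvgD; first exact: cvg_cst.
  by apply: cvgD; (apply: cvgM; [exact: cvg_cst|exact: cY]).
have act0 t : (0 <= action L Q (nu t) (V t))%E by exact: action_ge0.
have := transport_dist_le hL ce (integral_le_interior cE act0 action_le).
rewrite nu0 nu1 => /le_trans; apply; rewrite lee_fin ler_wsqrtr // E_def.
rewrite Rintegral_pow01_comb.
by rewrite /b0 /b1 /b2 le_eqVlt; apply/orP; left; apply/eqP; ring.
Qed.

End estimate.

(* [N = 2 * k + 1], [m = l ^ 2], and [K] is the constant of the interaction. *)
Let gain_negative (N m K a zeta eta : R) : 1 <= N -> 0 <= K -> 0 <= a -> 0 < eta ->
  eta <= m -> 8 * K * a <= eta / 12 -> 24 * K <= eta * N -> zeta <= eta / 12 ->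
  zeta - m + 4 * (N + 1) * K * (a + 1 / 4) / N + (2 * m - (N + 1) * K) / (N + 2) < 0.
Proof.
move=> N1 K0 a0 eta0 em hKa hKN hz; have N0 : 0 < N by lra.
have m0 : 0 < m by lra.
have KN : K / N <= eta / 24 by rewrite ler_pdivrMr //; lra.
have E : 4 * (N + 1) * K * (a + 1 / 4) / N + (2 * m - (N + 1) * K) / (N + 2) =
    4 * K * a * (1 + N^-1) + (K / N + K / (N + 2)) + 2 * m / (N + 2).
  by field; rewrite !gt_eqF //; lra.
have N2 : 0 < N + 2 by lra.
have h1 : 4 * K * a * (1 + N^-1) <= 4 * K * a * 2.
  by rewrite ler_wpM2l ?mulr_ge0 // (_ : 2 = 1 + 1) // lerD2l invf_le1.
have h2 : K / (N + 2) <= K / N.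
  by rewrite ler_wpM2l // lef_pV2 ?posrE // lerDl.
have h3 : 2 * m / (N + 2) <= 2 * m / 3.
  by rewrite ler_wpM2l ?mulr_ge0 ?(ltW m0) // lef_pV2 ?posrE //; lra.
rewrite -addrA E; lra.
Qed.

(** The interaction is at most [K * (a + t * (1 - t))] times the variation of the
    squared plateau. The choice of [a] controls the first summand and that of [k]
    the second, by concentrating the variation near the ends; [eps], chosen last,
    makes the quadratic cost of the exchange negligible. *)
Lemma edge_shortcut : (forall s : R, 0 < s -> L s t @[t --> +oo] --> +oo) ->
  exists a : R, [/\ 0 < a, a < 1 / 2 & forall l X, edge_arc a l X ->
    (transport_dist L Q (edge a) (edge (1 - a)) < l%:E)%E].
Proof.
move=> hLinf.
have [K K0 HK] := cross_uniform.
pose eta := (4 * Cmax)^-1.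
have eta0 : 0 < eta by rewrite invr_gt0 mulr_gt0 // conductance_max_gt0.
have K1 : 0 < 96 * (K + 1) by rewrite mulr_gt0 //; lra.
pose a := Num.min (1 / 4) (eta / (96 * (K + 1))).
have a0 : 0 < a by rewrite lt_min !divr_gt0.
have a4 : a <= 1 / 4 by rewrite ge_min lexx.
have aK : a * (96 * (K + 1)) <= eta by rewrite -ler_pdivlMr // ge_min lexx orbT.
exists a; split=> //; first lra.
move=> l X arc; have l0 := arc_l_gt0 arc.
(* The exponent [k] makes the plateau steep only near its ends. *)
pose k := Num.bound (24 * K / eta).
have kK : 24 * K <= eta * k%:R.
  have k0 : 0 <= 24 * K / eta by rewrite divr_ge0 ?(ltW eta0) // mulr_ge0.
  have := archi_boundP k0; rewrite -/k => /ltW.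
  by rewrite ler_pdivrMr // [leRHS]mulrC.
pose c := Num.min (Num.min (a * Q pt1 pt3 / 2) (a * Q pt2 pt3 / 2))
  (Num.min (Q pt3 pt1) (Q pt3 pt2)).
have c0 : 0 < c by rewrite !lt_min q31 q32 !divr_gt0 // mulr_gt0.
pose zeta := eta / 12.
have z0 : 0 < zeta by rewrite divr_gt0.
pose T := 128 * k.+1%:R ^+ 2 / (c * zeta).
have := hLinf 1 ltr01 => /cvgryPge /(_ T) [M [_ HM]].
pose eps := Num.min (1 / 2) (`|M| + 1)^-1.
have M1 : 0 < `|M| + 1 by rewrite ltr_wpDl.
have eps0 : 0 < eps by rewrite lt_min divr_gt0 ?invr_gt0.
have eps1 : eps <= 1 / 2 by rewrite ge_min lexx.
have epsM : M < eps^-1.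
  apply: le_lt_trans (ler_norm M) _; apply: (@lt_le_trans _ _ (`|M| + 1)).
    by rewrite ltrDl.
  by rewrite -[leLHS]invrK lef_pV2 ?posrE ?invr_gt0 // ge_min lexx orbT.
have TL : T <= L 1 eps^-1 by exact: HM.
have T0 : 0 < T by rewrite divr_gt0 ?mulr_gt0 ?exprn_gt0.
have zetaP : 128 * k.+1%:R ^+ 2 / (c * L 1 eps^-1) <= zeta.
  have Le : 0 < L 1 eps^-1 by exact: lt_le_trans TL.
  move: TL; rewrite /T !ler_pdivrMr ?mulr_gt0 // => /le_trans; apply.
  by rewrite le_eqVlt; apply/orP; left; apply/eqP; ring.
have c13 : c <= a * Q pt1 pt3 / 2 by rewrite !ge_min lexx.
have c23 : c <= a * Q pt2 pt3 / 2 by rewrite !ge_min lexx ?orbT.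
have c31 : c <= Q pt3 pt1 by rewrite !ge_min lexx ?orbT.
have c32 : c <= Q pt3 pt2 by rewrite !ge_min lexx ?orbT.
have := shortcut_bound arc (HK _ _ _ arc) eps0 eps1 c0 c13 c23 c31 c32 zetaP.
move=> /le_lt_trans; apply; rewrite lte_fin.
rewrite -[ltRHS](gtr0_norm l0) -sqrtr_sqr ltr_sqrt ?exprn_gt0 // gtrDl pmulr_rlt0 //.
have := @gain_negative (k.*2.+1)%:R (l ^+ 2) K a zeta eta.
have -> : (k.*2.+1)%:R + 1 = 2 * k.+1%:R :> R.
  by rewrite -[k.*2.+1]addn1 -[k.+1]addn1 -mul2n !natrD natrM; ring.
have -> : (k.*2.+1)%:R + 2 = (k.+1.*2.+1)%:R :> R.
  by rewrite doubleS -natrD addn2.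
have -> : 8 * k.+1%:R * K * (a + 1 / 4) = 4 * (2 * k.+1%:R) * K * (a + 1 / 4) by ring.
apply=> //; rewrite ?(ltW a0) //.
- by rewrite ler1n.
- exact: (arc_length_lower arc a4).
- lra.
- apply: le_trans kK _; rewrite ler_wpM2l ?(ltW eta0) // ler_nat.
  by rewrite -addnn -addnS leq_addr.
Qed.

End three_points.

(** * Geodesics between the first two vertices *)

Theorem theorem6p3 (R : realType) (L : R -> R -> R)
  (hL : admissible_mean L)
  (hLinf : forall s : R, 0 < s -> L s t @[t --> +oo] --> +oo)
  (hL0inf : (forall t : R, 0 < t -> 0 < L 0 t) -> L 0 t @[t --> +oo] --> +oo)
  (Q : 'I_3 -> 'I_3 -> R) (ppi : 'I_3 -> R)
  (hQ : markov_triple Q ppi)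
  (hQpos : forall x y : 'I_3, x != y -> 0 < Q x y)
  (mu : R -> 'I_3 -> R)
  (hgeo : transport_geodesic L Q mu)
  (hmu0 : mu 0 = dirac_prob R pt1)
  (hmu1 : mu 1 = dirac_prob R pt2) :
  exists t : R, 0 < t /\ t < 1 /\ 0 < mu t pt3.
Proof.
apply: contrapT => /forallNP mu3.
have Qge0 := mt_rate_ge0 hQ; have [pmu geo] := hgeo.
pose u t := mu t pt2.
have mu_edge t : 0 <= t <= 1 -> mu t = edge (u t).
  move=> t01; have [m0 m1] := pmu t t01.
  have m3 : mu t pt3 = 0.
    have [t0|t0] := eqVneq t 0; first by rewrite t0 hmu0.
    have [t1|t1] := eqVneq t 1; first by rewrite t1 hmu1.
    apply/eqP; rewrite eq_le m0 andbT leNgt; apply/negP => m30.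
    by apply: (mu3 t); do 2 (split; first by rewrite lt_neqAle; lra).
  move: m1; rewrite sum3 m3 addr0 => /eqP; rewrite eq_sym -subr_eq => /eqP m1.
  by apply/funext => z; have [->|->|->] := pt_cases z; rewrite /edge /u //= m1.
have [D DE] : exists D : R, transport_dist L Q (mu 0) (mu 1) = D%:E.
  have [A] := vertex_dist_fin hL Qge0 hQpos; rewrite -hmu0 -hmu1.
  have := @transport_dist_coordinate _ _ hL _ _ Qge0 (mu 0) (mu 1) pt1.
  by case: (transport_dist _ _ _ _) => [D _ _| |] //; exists D.
have dist s t : 0 <= s <= 1 -> 0 <= t <= 1 ->
    transport_dist L Q (edge (u s)) (edge (u t)) = (`|t - s| * D)%:E.
  by move=> s01 t01; rewrite -!mu_edge // geo // DE EFinM.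
have D0 : 0 <= D.
  have := @transport_dist_coordinate _ _ hL _ _ Qge0 (mu 0) (mu 1) pt1.
  by rewrite DE lee_fin; apply: le_trans; rewrite divr_ge0 ?sqrtr_ge0.
have u0 : u 0 = 0 by rewrite /u hmu0.
have u1 : u 1 = 1 by rewrite /u hmu1.
pose B := Num.sqrt (speed_bound Q).
have B0 : 0 < B by rewrite sqrtr_gt0; exact: speed_bound_gt0.
have u_lip s t : 0 <= s <= 1 -> 0 <= t <= 1 -> `|u t - u s| <= B * D * `|t - s|.
  move=> s01 t01; have := @transport_dist_coordinate _ _ hL _ _ Qge0 (mu s) (mu t) pt2.
  by rewrite !mu_edge // dist // lee_fin ler_pdivrMr // mulrC mulrA mulrAC mulrC mulrA.
have u_near t0 r : 0 <= t0 <= 1 -> 0 < r -> exists2 d : R, 0 < d &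
    forall t, 0 <= t <= 1 -> `|t - t0| < d -> `|u t - u t0| < r.
  move=> t01 r0; exists (r / (B * D + 1)).
    by rewrite divr_gt0 // ltr_wpDl // mulr_ge0 // ltW.
  move=> t t01' td; apply: le_lt_trans (u_lip _ _ t01 t01') _.
  move: td; rewrite ltr_pdivlMr ?ltr_wpDl ?mulr_ge0 ?(ltW B0) //.
  by have := normr_ge0 (t - t0); lra.
have cu : {within `[0, 1], continuous u}.
  apply/subspace_continuousP => t; rewrite /= in_itv /= => t01.
  apply/cvgrPdist_lt => e e0; have [d d0 hd] := u_near t e t01 e0.
  rewrite near_withinE; apply/nbhs_ballP; exists d => // s; rewrite /ball /= => ts.
  by rewrite in_itv /= => s01; rewrite distrC hd // distrC.
have [a [a0 ah short]] := edge_shortcut hL Qge0 hQpos hLinf.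
pose b := 1 - a.
have ab : a < b by rewrite /b; lra.
have IVTu x : 0 <= x <= 1 -> exists2 t, 0 <= t <= 1 & u t = x.
  move=> x01; have [|t] := @IVT R u 0 1 x ler01 cu.
    by rewrite u0 u1 (min_idPl ler01) (max_idPr ler01).
  by rewrite in_itv /=; exists t.
have [ta ta01 uta] : exists2 t, 0 <= t <= 1 & u t = a by apply: IVTu; lra.
have [tb tb01 utb] : exists2 t, 0 <= t <= 1 & u t = b by apply: IVTu; rewrite /b; lra.
pose f x := (Num.sqrt (conductance L Q x))^-1.
have C0 x : 0 < x < 1 -> 0 < conductance L Q x.
  exact: (conductance_gt0 hL hQpos).
have cf x : a / 2 <= x <= 1 - a / 2 -> {for x, continuous f}.
  move=> xa; have x01 : 0 < x < 1 by lra.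
  apply: cvgV; first by rewrite gt_eqF // sqrtr_gt0 C0.
  apply: (@continuous_comp _ _ _ (conductance L Q) Num.sqrt).
    exact: (conductance_continuous hL hQpos).
  exact: sqrt_continuous.
have [|F dF] := exists_primitive _ cf; first lra.
have f_gt0 x : a / 2 < x < 1 - a / 2 -> 0 < f x.
  by move=> xa; rewrite invr_gt0 sqrtr_gt0 C0 //; lra.
have [||X [X0 X1 HX]] := inverse_primitive f_gt0 dF _ ab _; [lra|rewrite /b; lra|].
set l := F b - F a in HX.
have l0 : 0 < l.
  have [||z zab] := primitive_MVT dF _ (ltW ab) _; [lra|rewrite /b; lra|].
  rewrite -/l => ->; rewrite mulr_gt0 ?subr_gt0 // f_gt0 //.
  by move: zab; rewrite /b; lra.
have arc : edge_arc L Q a l X.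
  split=> // t t01; have [Xt _ dX] := HX t t01; first exact: Xt.
  by move: dX; rewrite /f invrK.
have {}short := short l X arc.
have tab : transport_dist L Q (edge a) (edge b) = (`|tb - ta| * D)%:E.
  by rewrite -uta -utb dist.
have {short} short : `|tb - ta| * D < l by move: short; rewrite -/b tab lte_fin.
(* The curve may leave the arc between the times [ta] and [tb]; clamping brings
   it back without increasing distances. *)
pose clamp x := Num.max a (Num.min x b).
have clamp_lo x : x <= a -> clamp x = a.
  by move=> xa; rewrite /clamp (min_idPl (le_trans xa (ltW ab))) (max_idPl xa).
have clamp_hi x : b <= x -> clamp x = b.
  by move=> bx; rewrite /clamp (min_idPr bx) (max_idPr (ltW ab)).
have clamp_mid x : a <= x <= b -> clamp x = x.
  by move=> /andP[ax xb]; rewrite /clamp (min_idPl xb) (max_idPr ax).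
have clamp_lip x y : a <= y <= b -> `|clamp x - y| <= `|x - y|.
  exact: (clamp_lipschitz _ (ltW ab)).
(* Measured by the arc length [F], the geodesic has speed at most [D]. *)
have h_lip th : 0 < th -> forall s t, 0 <= s -> s <= t -> t <= 1 ->
    `|F (clamp (u t)) - F (clamp (u s))| <= (1 + th) ^+ 2 * D * (t - s).
  move=> th0; have th1 : 0 < 1 + th by exact: addr_gt0.
  apply: (@local_lipschitz R (fun t => F (clamp (u t)))).
    by rewrite mulr_ge0 ?sqr_ge0.
  move=> t0 t01; have rhs0 t : 0 <= (1 + th) ^+ 2 * D * `|t - t0|.
    by rewrite mulr_ge0 // mulr_ge0 ?sqr_ge0.
  have [ua|ua] := ltP (u t0) a.
    have [d d0 hd] := u_near t0 (a - u t0) t01 ltac:(by rewrite subr_gt0).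
    exists d => // t t01' td; rewrite !clamp_lo ?subrr ?normr0 ?(ltW ua) //.
    by have := hd t t01' td; rewrite ltr_norml; lra.
  have [ub|ub] := ltP b (u t0).
    have [d d0 hd] := u_near t0 (u t0 - b) t01 ltac:(by rewrite subr_gt0).
    exists d => // t t01' td; rewrite !clamp_hi ?subrr ?normr0 ?(ltW ub) //.
    by have := hd t t01' td; rewrite ltr_norml; lra.
  have uab : a <= u t0 <= b by rewrite ua ub.
  have u01 : 0 < u t0 < 1 by move: uab; rewrite /b; lra.
  have ucd : a / 2 < u t0 < 1 - a / 2 by move: uab; rewrite /b; lra.
  have clu := clamp_mid _ uab.
  set c := conductance L Q (u t0).
  have c0 : 0 < c by exact: C0.
  have sc0 : 0 < Num.sqrt c by rewrite sqrtr_gt0.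
  have cM : c < c * (1 + th) ^+ 2.
    by rewrite ltr_pMr // exprn_egt1 // ltrDl.
  have /andP[u00 u11] := u01.
  have [r1 r10 hr1] := edge_dist_lower hL Qge0 hQpos u00 u11 cM.
  have e0 : 0 < f (u t0) * th by rewrite mulr_gt0 // f_gt0.
  have [r2 r20 hr2] := is_derive_local_lipschitz (dF _ ucd) e0.
  have [d d0 hd] := u_near t0 (Num.min r1 r2) t01 ltac:(by rewrite lt_min r10).
  exists d => // t t01' td; have := hd t t01' td; rewrite lt_min => /andP[ur1 ur2].
  have := hr1 _ ur1; rewrite dist // lee_fin.
  rewrite sqrtrM ?(ltW c0) // sqrtr_sqr (gtr0_norm th1) ler_pdivrMr ?mulr_gt0 //.
  move=> hu; rewrite clu.
  have cl := clamp_lip (u t) _ uab.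
  apply: le_trans (hr2 _ (le_lt_trans cl ur2)) _.
  rewrite (gtr0_norm (f_gt0 _ ucd)).
  have -> : f (u t0) + f (u t0) * th = f (u t0) * (1 + th) by ring.
  have f1 : 0 <= f (u t0) * (1 + th) by exact: mulr_ge0 (ltW (f_gt0 _ ucd)) (ltW th1).
  apply: le_trans (ler_wpM2l f1 (le_trans cl hu)) _.
  rewrite /f -/c le_eqVlt; apply/orP; left; apply/eqP; field; rewrite gt_eqF //.
set W := `|tb - ta| * D in short.
have W0 : 0 <= W by rewrite mulr_ge0.
have l_le th : 0 < th -> l <= (1 + th) ^+ 2 * W.
  move=> th0; have clb : clamp b = b by rewrite clamp_hi.
  have cla : clamp a = a by rewrite clamp_lo.
  have [/andP[ta0 ta1] /andP[tb0 tb1]] := (ta01, tb01).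
  have [tab'|/ltW tba] := leP ta tb.
    have := h_lip th th0 ta tb ta0 tab' tb1.
    rewrite uta utb clb cla -/l (gtr0_norm l0) /W ger0_norm ?subr_ge0 //.
    by rewrite -mulrA [D * _]mulrC.
  have := h_lip th th0 tb ta tb0 tba ta1.
  rewrite uta utb clb cla distrC -/l (gtr0_norm l0) /W distrC ger0_norm ?subr_ge0 //.
  by rewrite -mulrA [D * _]mulrC.
(* Any [th] with [(1 + th) ^ 2 * W < l] contradicts [l_le]. *)
pose th := Num.min 1 ((l - W) / (3 * (W + 1))).
have W1 : 0 < 3 * (W + 1) by lra.
have th0 : 0 < th by rewrite lt_min ltr01 divr_gt0 // subr_gt0.
have th1 : th <= 1 by rewrite ge_min lexx.
have thW : th * (3 * (W + 1)) <= l - W by rewrite -ler_pdivlMr // ge_min lexx orbT.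
have := l_le th th0.
have : (1 + th) ^+ 2 * W <= (1 + 3 * th) * W.
  rewrite ler_wpM2r // -subr_ge0 (_ : _ - _ = th * (1 - th)); last by ring.
  by rewrite mulr_ge0 ?subr_ge0 // ltW.
lra.
Qed.
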